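(* Let $A,B$ be real numbers with $-1<A\le 1$ and $-1\le B<A$, and let $b\neq 0$ be a complex number. The radius of starlikeness of the class $S^{*}(A,B,b)$ is $$r_s=\frac{2}{|b|(A-B)+\sqrt{|b|^{2}(A-B)^{2}+4\left[B^{2}+(AB-B^{2})\,\mathrm{Re}\, b\right]}}.$$ This radius is sharp, an extremal function being $$f_{*}(z)=\begin{cases} z(1+Bz)^{\frac{b(A-B)}{B}}, & B\neq 0,\\ z e^{bAz}, & B=0.\end{cases}$$
   Context: Let $D=\{z\in\mathbb{C}:|z|<1\}$. Let $\Omega$ be the family of functions $\omega$ analytic in $D$ with $\omega(0)=0$ and $|\omega(z)|<1$ for $z\in D$. For real $A,B$ with $-1<A\le1$, $-1\le B<A$, let $P(A,B)$ be the family of functions $p(z)=1+p_1z+p_2z^2+\cdots$ analytic in $D$ such that $p(z)=\frac{1+A\omega(z)}{1+B\omega(z)}$ for all $z\in D$, for some $\omega\in\Omega$. For complex $b\ne0$, $S^{*}(A,B,b)$ is the family of functions $f(z)=z+a_2z^2+a_3z^3+\cdots$ analytic in $D$ such that $1+\frac1b\left(z\frac{f'(z)}{f(z)}-1\right)=p(z)$ for all $z\in D$, for some $p\in P(A,B)$ (the left side taken by continuity at $z=0$). Radius of starlikeness: ''the radius of starlikeness of the class is $r_s$'' means that every $f\in S^{*}(A,B,b)$ satisfies $\mathrm{Re}\left(z\frac{f'(z)}{f(z)}\right)>0$ for all $z\in D$ with $|z|<r_s$, and that $r_s$ cannot be replaced by a larger radius within the unit disc: for every $r$ with $r_s<r\le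 1$ there is a function in the class for which this inequality fails at some point of $|z|<r$. ''Sharp with extremal function $f_*$'' means that $f_*$ belongs to the class and is such a function. The power $(1+Bz)^{c}$ is the branch $\exp(c\log(1+Bz))$ equal to $1$ at $z=0$. *)

(* Defs.v *)
From Stdlib Require Import Reals.
From Coquelicot Require Import Coquelicot.

Local Open Scope R_scope.

Definition unit_disc (z : C) : Prop := Cmod z < 1.

(* The elements of the families below are total functions [C -> C], of which
   only the values in the unit disc matter. *)

Definition analytic_at (f : C -> C) (z0 : C) : Prop :=
  exists (a : nat -> C) (r : R), 0 < r /\
    forall z : C, Cmod (z - z0)%C < r ->
      @is_pseries C_AbsRing C_NormedModule a (z - z0)%C (f z).

Definition analytic_in_disc (f : C -> C) : Prop :=
  forall z : C, unit_disc z -> analytic_at f z.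

Definition expansion_in_disc (a : nat -> C) (f : C -> C) : Prop :=
  forall z : C, unit_disc z -> @is_pseries C_AbsRing C_NormedModule a z (f z).

Definition Omega (w : C -> C) : Prop :=
  analytic_in_disc w /\ w 0%C = 0%C /\
  forall z : C, unit_disc z -> Cmod (w z) < 1.

Definition P_class (A B : R) (p : C -> C) : Prop :=
  analytic_in_disc p /\
  (exists a : nat -> C, a 0%nat = 1%C /\ expansion_in_disc a p) /\
  exists w : C -> C, Omega w /\
    forall z : C, unit_disc z -> p z = ((1 + A * w z) / (1 + B * w z))%C.

(* z f'(z) / f(z), taken by continuity at z = 0, where the plain quotient is
   0 / 0 for a function vanishing at the origin. *)
Definition star_quotient (f : C -> C) (z : C) : C :=
  if Ceq_dec z 0%C
  then C_lim (fun w : C => (w * C_derive f w / f w)%C) 0%C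
  else (z * C_derive f z / f z)%C.

(* The condition [f z <> 0] says that the quotient is defined at z; it is
   explicit because division in Rocq is total. *)
Definition S_star (A B : R) (b : C) (f : C -> C) : Prop :=
  analytic_in_disc f /\
  (exists a : nat -> C,
     a 0%nat = 0%C /\ a 1%nat = 1%C /\ expansion_in_disc a f) /\
  (forall z : C, unit_disc z -> z <> 0%C -> f z <> 0%C) /\
  exists p : C -> C, P_class A B p /\
    forall z : C, unit_disc z ->
      (1 + 1 / b * (star_quotient f z - 1))%C = p z.

Definition starlike_fails_within (f : C -> C) (r : R) : Prop :=
  exists z : C, Cmod z < r /\ ~ 0 < Re (star_quotient f z).

Definition is_radius_of_starlikeness (S : (C -> C) -> Prop) (rs : R) : Prop :=
  (forall f : C -> C, S f ->
     forall z : C, unit_disc z -> Cmod z < rs -> 0 < Re (star_quotient f z)) /\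
  (forall r : R, rs < r <= 1 ->
     exists f : C -> C, S f /\ starlike_fails_within f r).

Definition is_extremal_function
    (S : (C -> C) -> Prop) (rs : R) (f : C -> C) : Prop :=
  S f /\ forall r : R, rs < r <= 1 -> starlike_fails_within f r.

Definition Cexp (z : C) : C :=
  (exp (Re z) * cos (Im z), exp (Re z) * sin (Im z)).

(* Principal argument, with values in (-PI, PI] for z <> 0. *)
Definition Carg (z : C) : R :=
  if Rle_dec 0 (Im z) then acos (Re z / Cmod z) else - acos (Re z / Cmod z).

(* Principal logarithm.  For |B| <= 1 and |z| < 1 the point 1 + B z lies in the
   right half-plane, so [Clog (1 + B z)] is the analytic branch on the disc
   vanishing at z = 0. *)
Definition Clog (z : C) : C := (ln (Cmod z), Carg z).

Definition Cpower (z c : C) : C := Cexp (c * Clog z)%C.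

Definition f_star (A B : R) (b z : C) : C :=
  if Req_EM_T B 0
  then (z * Cexp (b * A * z))%C
  else (z * Cpower (1 + B * z) (b * (A - B) / B))%C.

Definition r_s (A B : R) (b : C) : R :=
  2 / (Cmod b * (A - B) +
       sqrt (Cmod b ^ 2 * (A - B) ^ 2 + 4 * (B ^ 2 + (A * B - B ^ 2) * Re b))).

(* Main.v *)
Require Import Defs.
From Stdlib Require Import Reals Lra Lia ClassicalEpsilon Classical.
From Coquelicot Require Import Coquelicot.

Local Open Scope R_scope.

(** If f is in the class, then z f'(z) / f(z) = 1 + b (A - B) w / (1 + B w),
    where w = w(z) and |w(z)| <= |z| by the Schwarz lemma ([schwarz]). As w runs
    over the circle |w| = r, the quotient w / (1 + B w) runs over an explicit
    circle, so the minimum of the real part is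
    (1 - |b| (A - B) r - (B^2 + (A B - B^2) Re b) r^2) / (1 - B^2 r^2)
    ([Re_disc_lower_bound], attained by [extremal_point]). Its numerator is
    positive on [0, r_s) and vanishes at r_s ([r_s_factor]). For f_* the function
    w is the identity ([star_quotient_f_star]), so when r_s < 1 the real part
    vanishes at some point of modulus r_s and the radius is sharp.

    Two parts of this are analysis. The Schwarz lemma rests on a maximum modulus
    principle that needs only second order Taylor expansions: |g|^2 + e |z|^2,
    for e > 0, is strictly below its mean over four nearby points, so its maximum
    over a closed disc is attained on the boundary only ([maximum_modulus]).

    Membership of f_* in the class requires convergent expansions at every point
    of the disc, and over the whole disc at the origin. The factor F = f_* / z
    solves (1 + B z) F' = b (A - B) F, for B = 0 too. The recurrence for the
    coefficients of a power series solution gives a series with the right radius;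
    along each ray it is a real power series in the parameter, and multiplying it
    by the exponential of minus the logarithm of F gives a function with zero
    derivative ([ode_series]). The derivative of f_* is then the coefficient of
    degree 1 of its local series ([C_derive_local_series]). *)


(** * Local power series *)

(** The analogue of [analytic_at] with the radius and the coefficients exposed
    and the centre moved to the origin, so that expansions of [f] at [z0] are
    expansions of [fun z => f (z0 + z)]. *)
Definition local_series (a : nat -> C) (r : R) (g : C -> C) : Prop :=
  forall z : C, Cmod z < r ->
    @is_pseries C_AbsRing C_NormedModule a z (g z).

Lemma Cmod_pow_n (z : C) (n : nat) : Cmod (@pow_n C_AbsRing z n) = Cmod z ^ n.
Proof. exact (Cmod_pow z n). Qed.

Lemma norm_Cmod (x : C) : @norm C_AbsRing C_NormedModule x = Cmod x.
Proof. reflexivity. Qed.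

(** The terms are bounded at the point [r / 2], hence dominated by a geometric
    series of ratio [1 / 2] on the disc of radius [r / 4]. *)
Lemma local_series_bounded (a : nat -> C) (r : R) (g : C -> C) :
  0 < r -> local_series a r g ->
  exists K d : R, 0 < d <= r /\ forall z : C, Cmod z < d -> Cmod (g z) <= K.
Proof.
intros Hr Hg.
assert (Hs : Cmod (RtoC (r / 2)) = r / 2)
  by (rewrite Cmod_R; apply Rabs_pos_eq; lra).
assert (Hlim := Hg (RtoC (r / 2)) ltac:(rewrite Hs; lra)).
destruct (filterlim_bounded _ (ex_intro _ _ Hlim)) as [M HM].
assert (Hterm : forall n, (r / 2) ^ n * Cmod (a n) <= 2 * M).
{ intros n.
  rewrite <- Hs, <- Cmod_pow_n, <- Cmod_mult.
  change (@pow_n C_AbsRing (RtoC (r / 2)) n * a n)%C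
    with (@scal _ C_NormedModule (@pow_n C_AbsRing (RtoC (r / 2)) n) (a n)).
  destruct n as [|n].
  - specialize (HM 0%nat). rewrite sum_O, norm_Cmod in HM.
    assert (H0 := Cmod_ge_0
      (@scal C_AbsRing C_NormedModule (@pow_n C_AbsRing (RtoC (r / 2)) 0) (a 0%nat))).
    lra.
  - assert (H1 := HM n). assert (H2 := HM (S n)).
    rewrite sum_Sn in H2. rewrite norm_Cmod in H1, H2.
    set (x := sum_n _ n) in *. set (y := scal _ _) in *.
    change (plus x y) with (x + y)%C in H2.
    replace (y : C) with ((x + y) + - x)%C by ring.
    eapply Rle_trans; [apply Cmod_triangle|]. rewrite Cmod_opp. lra. }
exists (4 * M), (r / 4). split; [lra|].
intros z Hz.
assert (Hb : forall n, norm (sum_n (fun k => @scal _ C_NormedModule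
    (@pow_n C_AbsRing z k) (a k)) n) <= 4 * M - 2 * M * (/ 2) ^ n).
{ assert (Ht : forall n, Cmod (@scal _ C_NormedModule
    (@pow_n C_AbsRing z n) (a n)) <= 2 * M * (/ 2) ^ n).
  { intros n.
    change (Cmod (@pow_n C_AbsRing z n * a n)%C <= 2 * M * (/ 2) ^ n).
    rewrite Cmod_mult, Cmod_pow_n.
    apply Rle_trans with ((r / 4) ^ n * Cmod (a n)).
    - apply Rmult_le_compat_r; [apply Cmod_ge_0|].
      apply pow_incr. split; [apply Cmod_ge_0|lra].
    - replace (r / 4) with (r / 2 * / 2) by lra.
      rewrite Rpow_mult_distr.
      assert (Hp : 0 < (/ 2) ^ n) by (apply pow_lt; lra).
      specialize (Hterm n). nra. }
  induction n as [|n IH].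
  - rewrite sum_O, norm_Cmod. specialize (Ht 0%nat). rewrite pow_O in Ht |- *. lra.
  - rewrite sum_Sn. eapply Rle_trans; [apply norm_triangle|].
    specialize (Ht (S n)). rewrite <- norm_Cmod in Ht.
    rewrite <- tech_pow_Rmult in Ht |- *. lra. }
assert (HM0 : 0 <= M)
  by (assert (T := Hterm 0%nat); assert (T' := Cmod_ge_0 (a 0%nat));
      rewrite pow_O in T; lra).
rewrite <- norm_Cmod.
apply (is_lim_seq_le (fun n => norm (sum_n (fun k => @scal _ C_NormedModule
    (@pow_n C_AbsRing z k) (a k)) n)) (fun _ => 4 * M)
    (norm (g z : C_NormedModule)) (4 * M)).
- intros n. eapply Rle_trans; [apply Hb|].
  assert (Hp : 0 < (/ 2) ^ n) by (apply pow_lt; lra). nra.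
- apply (filterlim_comp _ _ _ _ norm eventually (locally (g z)) _);
    [apply Hg; lra
    | exact (@filterlim_norm C_AbsRing C_NormedModule (g z))].
- apply is_lim_seq_const.
Qed.

Lemma local_series_center (a : nat -> C) (r : R) (g : C -> C) :
  0 < r -> local_series a r g -> g 0%C = a 0%nat.
Proof.
intros Hr Hg.
assert (H := Hg 0%C ltac:(rewrite Cmod_0; lra)).
assert (H0 := @is_pseries_0 C_AbsRing C_NormedModule a).
exact (@filterlim_locally_unique nat C_AbsRing C_NormedModule eventually _
  (sum_n (fun k => @scal _ C_NormedModule (@pow_n C_AbsRing (RtoC 0) k) (a k)))
  (g 0%C) (a 0%nat) H H0).
Qed.

(** Iterated with [local_series_bounded], this yields Taylor expansions of any
    order with a bounded remainder factor. *)
Lemma local_series_shift (a : nat -> C) (r : R) (g : C -> C) :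
  0 < r -> local_series a r g ->
  exists g1 : C -> C, local_series (PS_decr_1 a) r g1 /\
    forall z : C, Cmod z < r -> g z = (a 0%nat + z * g1 z)%C.
Proof.
intros Hr Hg.
exists (fun z => if Ceq_dec z 0%C then a 1%nat else (/ z * (g z - a 0%nat))%C).
split; intros z Hz; destruct (Ceq_dec z 0%C) as [->|Hz0].
- apply (@is_pseries_0 C_AbsRing C_NormedModule (PS_decr_1 a)).
- apply (is_pseries_decr_1 (K := C_AbsRing) (V := C_NormedModule)).
  + change (/ z * z = 1)%C. now apply Cinv_l.
  + now apply Hg.
- rewrite (local_series_center a r g Hr Hg). ring.
- field. exact Hz0.
Qed.

(** * The maximum modulus principle and the Schwarz lemma *)

(** Second order is exactly what the maximum principle below consumes. Unlike
    power series, such expansions are divided by [z] with no rearrangement. *)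
Definition taylor2 (g : C -> C) (z0 : C) : Prop :=
  exists (c0 c1 c2 : C) (K d : R), 0 < d /\ forall z : C, Cmod z < d ->
    exists h : C, Cmod h <= K /\
      g (z0 + z)%C = (c0 + c1 * z + c2 * (z * z) + z * z * z * h)%C.

Lemma local_series_taylor2 (a : nat -> C) (r : R) (g : C -> C) (z0 : C) :
  0 < r -> local_series a r (fun z => g (z0 + z)%C) -> taylor2 g z0.
Proof.
intros Hr Hg.
destruct (local_series_shift _ _ _ Hr Hg) as [g1 [Hg1 E1]].
destruct (local_series_shift _ _ _ Hr Hg1) as [g2 [Hg2 E2]].
destruct (local_series_shift _ _ _ Hr Hg2) as [g3 [Hg3 E3]].
destruct (local_series_bounded _ _ _ Hr Hg3) as [K [d [Hd HK]]].
exists (a 0%nat), (PS_decr_1 a 0%nat), (PS_decr_1 (PS_decr_1 a) 0%nat), K, d.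
split; [lra|].
intros z Hz. exists (g3 z). split; [now apply HK|].
rewrite E1, E2, E3 by lra. ring.
Qed.

(** Divide the quadratic part by [z0 + z] from the low order end: the
    quotient [d0 + d1 z + d2 z^2] leaves only a cubic remainder [- d2 z^3]. *)
Lemma taylor2_div_id (g : C -> C) (z0 : C) :
  z0 <> 0%C -> taylor2 g z0 -> taylor2 (fun z => g z / z)%C z0.
Proof.
intros Hz0 (c0 & c1 & c2 & K & d & Hd & H).
set (d0 := (c0 / z0)%C). set (d1 := ((c1 - d0) / z0)%C).
set (d2 := ((c2 - d1) / z0)%C).
assert (Hp : 0 < Cmod z0) by now apply Cmod_gt_0.
exists d0, d1, d2, ((K + Cmod d2) / (Cmod z0 / 2)), (Rmin d (Cmod z0 / 2)).
split; [apply Rmin_pos; lra|].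
intros z Hz.
assert (Hzd : Cmod z < d) by (eapply Rlt_le_trans; [apply Hz|apply Rmin_l]).
assert (Hzz : Cmod z < Cmod z0 / 2)
  by (eapply Rlt_le_trans; [apply Hz|apply Rmin_r]).
assert (Hlow : Cmod z0 / 2 <= Cmod (z0 + z)).
{ assert (T := Cmod_triangle (z0 + z) (- z)).
  rewrite Cmod_opp in T. replace (z0 + z + - z)%C with z0 in T by ring. lra. }
assert (Hne : (z0 + z)%C <> 0%C) by (apply Cmod_gt_0; lra).
destruct (H z Hzd) as [h [Hh E]].
exists ((h - d2) / (z0 + z))%C. split.
- rewrite Cmod_div by exact Hne.
  assert (T := Cmod_triangle h (- d2)). rewrite Cmod_opp in T.
  change (h + - d2)%C with (h - d2)%C in T.
  assert (T0 := Cmod_ge_0 (h - d2)).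
  unfold Rdiv. apply Rmult_le_compat; try lra.
  + left. apply Rinv_0_lt_compat. lra.
  + apply Rinv_le_contravar; lra.
- rewrite E. unfold d2, d1, d0. field. split; assumption.
Qed.

Lemma taylor2_ext_loc (f g : C -> C) (z0 : C) (r : R) :
  0 < r -> (forall z, Cmod z < r -> f (z0 + z)%C = g (z0 + z)%C) ->
  taylor2 f z0 -> taylor2 g z0.
Proof.
intros Hr E (c0 & c1 & c2 & K & d & Hd & H).
exists c0, c1, c2, K, (Rmin d r). split; [now apply Rmin_pos|].
intros z Hz. rewrite <- E.
- apply H. eapply Rlt_le_trans; [apply Hz|apply Rmin_l].
- eapply Rlt_le_trans; [apply Hz|apply Rmin_r].
Qed.

Lemma taylor2_continuous (g : C -> C) (z0 : C) :
  taylor2 g z0 ->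
  exists K d : R, 0 < d /\ 0 <= K /\ forall z : C, Cmod (z - z0) < d ->
    Cmod (g z - g z0) <= K * Cmod (z - z0).
Proof.
intros (c0 & c1 & c2 & K & d & Hd & H).
exists (Cmod c1 + Cmod c2 + K), (Rmin d 1).
assert (HK : 0 <= K).
{ destruct (H 0%C ltac:(rewrite Cmod_0; lra)) as [h [Hh _]].
  eapply Rle_trans; [apply Cmod_ge_0|apply Hh]. }
assert (P1 := Cmod_ge_0 c1). assert (P2 := Cmod_ge_0 c2).
split; [apply Rmin_pos; lra|]. split; [lra|].
intros z Hz. set (w := (z - z0)%C) in *.
assert (Hwd : Cmod w < d) by (eapply Rlt_le_trans; [apply Hz|apply Rmin_l]).
assert (Hw1 : Cmod w < 1) by (eapply Rlt_le_trans; [apply Hz|apply Rmin_r]).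
assert (Hw0 := Cmod_ge_0 w).
destruct (H 0%C ltac:(rewrite Cmod_0; lra)) as [h0 [_ E0]].
destruct (H w Hwd) as [h [Hh E]].
replace (z0 + 0)%C with z0 in E0 by ring.
replace (z0 + w)%C with z in E by (unfold w; ring).
rewrite E, E0.
replace (c0 + c1 * w + c2 * (w * w) + w * w * w * h -
  (c0 + c1 * 0 + c2 * (0 * 0) + 0 * 0 * 0 * h0))%C
  with ((c1 + c2 * w + w * w * h) * w)%C by ring.
rewrite Cmod_mult. apply Rmult_le_compat_r; [exact Hw0|].
eapply Rle_trans; [apply Cmod_triangle|].
apply Rplus_le_compat.
- eapply Rle_trans; [apply Cmod_triangle|]. rewrite Cmod_mult. nra.
- rewrite !Cmod_mult. assert (P3 := Cmod_ge_0 h).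
  assert (Cmod w * Cmod w <= 1) by nra.
  assert (0 <= Cmod w * Cmod w) by nra. nra.
Qed.

(** Parseval's identity over the fourth roots of unity: the cross terms of
    degrees up to 2 in [z] and its conjugate cancel. *)
Lemma four_point_mean (c0 c1 c2 : C) (t : R) :
  let P z := (c0 + c1 * z + c2 * (z * z))%C in
  Cmod (P (t, 0)) ^ 2 + Cmod (P (- t, 0)) ^ 2 +
  Cmod (P (0, t)) ^ 2 + Cmod (P (0, - t)) ^ 2 =
  4 * (Cmod c0 ^ 2 + Cmod c1 ^ 2 * t ^ 2 + Cmod c2 ^ 2 * t ^ 4).
Proof.
intros P. unfold P. rewrite !Cmod2_alt.
destruct c0 as [x0 y0], c1 as [x1 y1], c2 as [x2 y2].
unfold Re, Im; simpl. ring.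
Qed.

(** The function |g|^2 + e |z|^2 has positive Laplacian: its mean over
    [z0 + t], [z0 - t], [z0 + i t], [z0 - i t] exceeds its value at [z0] by at
    least [e t^2], up to an error of order [t^3] coming from the remainder. So
    it is larger at one of the four points when [t] is small. The term in [e]
    spares any study of the first nonzero coefficient of [g]. *)
Lemma perturbed_modulus_no_local_max (g : C -> C) (z0 : C) (e eta : R) :
  taylor2 g z0 -> 0 < e -> 0 < eta ->
  exists z : C, Cmod (z - z0) < eta /\
    Cmod (g z0) ^ 2 + e * Cmod z0 ^ 2 < Cmod (g z) ^ 2 + e * Cmod z ^ 2.
Proof.
intros (c0 & c1 & c2 & K & d & Hd & H) He Heta.
set (P z := (c0 + c1 * z + c2 * (z * z))%C).
set (M := Cmod c0 + Cmod c1 + Cmod c2).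
assert (P0 := Cmod_ge_0 c0). assert (P1 := Cmod_ge_0 c1).
assert (P2 := Cmod_ge_0 c2).
assert (E0 : g z0 = c0).
{ destruct (H 0%C ltac:(rewrite Cmod_0; lra)) as [h [_ E]].
  replace (z0 + 0)%C with z0 in E by ring. rewrite E. ring. }
assert (HK : 0 <= K).
{ destruct (H 0%C ltac:(rewrite Cmod_0; lra)) as [h [Hh _]].
  eapply Rle_trans; [apply Cmod_ge_0|apply Hh]. }
assert (HMK : 0 <= M * K) by (apply Rmult_le_pos; unfold M; lra).
set (t := Rmin (Rmin (d / 2) (eta / 2)) (Rmin 1 (e / (2 * (M * K) + 1)))).
assert (Hq : 0 < e / (2 * (M * K) + 1)) by (apply Rdiv_lt_0_compat; lra).
assert (Ht : 0 < t) by (unfold t; repeat apply Rmin_pos; lra).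
assert (Htd : t <= d / 2)
  by (unfold t; eapply Rle_trans; [apply Rmin_l|apply Rmin_l]).
assert (Hte : t <= eta / 2)
  by (unfold t; eapply Rle_trans; [apply Rmin_l|apply Rmin_r]).
assert (Ht1 : t <= 1)
  by (unfold t; eapply Rle_trans; [apply Rmin_r|apply Rmin_l]).
assert (Htq : t <= e / (2 * (M * K) + 1))
  by (unfold t; eapply Rle_trans; [apply Rmin_r|apply Rmin_r]).
assert (Hsmall : 2 * (M * K) * t < e).
{ assert (t * (2 * (M * K) + 1) <= e).
  { apply (Rmult_le_compat_r (2 * (M * K) + 1)) in Htq; [|lra].
    unfold Rdiv in Htq. rewrite Rmult_assoc, Rinv_l, Rmult_1_r in Htq by lra.
    exact Htq. }
  lra. }
assert (Hlow : forall z, Cmod z = t ->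
  Cmod (P z) ^ 2 - 2 * (M * K) * t ^ 3 <= Cmod (g (z0 + z)%C) ^ 2).
{ intros z Hz.
  destruct (H z ltac:(lra)) as [h [Hh E]].
  assert (HP : Cmod (P z) <= M).
  { unfold P, M. eapply Rle_trans; [apply Cmod_triangle|].
    apply Rplus_le_compat.
    - eapply Rle_trans; [apply Cmod_triangle|]. rewrite Cmod_mult, Hz. nra.
    - rewrite !Cmod_mult, Hz. assert (t * t <= 1) by nra. nra. }
  assert (T : Cmod (P z) <= Cmod (g (z0 + z)%C) + t ^ 3 * K).
  { assert (T := Cmod_triangle (g (z0 + z)%C) (- (z * z * z * h))).
    rewrite Cmod_opp, !Cmod_mult, Hz in T.
    replace (g (z0 + z)%C + - (z * z * z * h))%C with (P z) in T
      by (rewrite E; unfold P; ring).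
    eapply Rle_trans; [apply T|]. apply Rplus_le_compat_l.
    assert (0 < t * t * t) by (apply Rmult_lt_0_compat; nra).
    replace (t ^ 3) with (t * t * t) by ring. nra. }
  assert (T0 := Cmod_ge_0 (P z)). assert (T1 := Cmod_ge_0 (g (z0 + z)%C)).
  assert (T3 : 0 <= t ^ 3 * K) by (apply Rmult_le_pos; [apply pow_le; lra|lra]).
  destruct (Rle_dec (Cmod (P z)) (t ^ 3 * K)) as [Hc|Hc].
  - assert (Cmod (P z) ^ 2 <= M * (t ^ 3 * K)) by (simpl; nra).
    assert (0 <= Cmod (g (z0 + z)%C) ^ 2) by apply pow2_ge_0.
    assert (0 <= M * (t ^ 3 * K)) by (apply Rmult_le_pos; unfold M; lra).
    replace (2 * (M * K) * t ^ 3) with (2 * (M * (t ^ 3 * K))) by ring. lra.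
  - assert (Hsq : (Cmod (P z) - t ^ 3 * K) ^ 2 <= Cmod (g (z0 + z)%C) ^ 2)
      by (apply pow_incr; lra).
    assert (Cmod (P z) * (t ^ 3 * K) <= M * (t ^ 3 * K))
      by (apply Rmult_le_compat_r; lra).
    assert (0 <= (t ^ 3 * K) ^ 2) by apply pow2_ge_0.
    replace (2 * (M * K) * t ^ 3) with (2 * (M * (t ^ 3 * K))) by ring. nra. }
assert (Hmod : Cmod (t, 0) = t /\ Cmod (- t, 0) = t /\
  Cmod (0, t) = t /\ Cmod (0, - t) = t).
{ repeat split; unfold Cmod; simpl; apply sqrt_lem_1; nra. }
destruct Hmod as (M1 & M2 & M3 & M4).
assert (Hmean := four_point_mean c0 c1 c2 t). cbv zeta in Hmean.
change (Cmod (P (t, 0)) ^ 2 + Cmod (P (- t, 0)) ^ 2 +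
  Cmod (P (0, t)) ^ 2 + Cmod (P (0, - t)) ^ 2 =
  4 * (Cmod c0 ^ 2 + Cmod c1 ^ 2 * t ^ 2 + Cmod c2 ^ 2 * t ^ 4)) in Hmean.
(* The same identity for the affine function [z0 + z] gives the mean of the
   term in e. *)
assert (Hid := four_point_mean z0 1%C 0%C t). cbv zeta in Hid.
rewrite Cmod_1, Cmod_0 in Hid.
replace (z0 + 1 * (t, 0)%R + 0 * ((t, 0)%R * (t, 0)%R))%C
  with (z0 + (t, 0)%R)%C in Hid by ring.
replace (z0 + 1 * (- t, 0)%R + 0 * ((- t, 0)%R * (- t, 0)%R))%C
  with (z0 + (- t, 0)%R)%C in Hid by ring.
replace (z0 + 1 * (0, t)%R + 0 * ((0, t)%R * (0, t)%R))%C
  with (z0 + (0, t)%R)%C in Hid by ring.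
replace (z0 + 1 * (0, - t)%R + 0 * ((0, - t)%R * (0, - t)%R))%C
  with (z0 + (0, - t)%R)%C in Hid by ring.
assert (L1 := Hlow _ M1). assert (L2 := Hlow _ M2).
assert (L3 := Hlow _ M3). assert (L4 := Hlow _ M4).
apply NNPP. intros Hno.
assert (Hall : forall z, Cmod z = t -> Cmod (g (z0 + z)%C) ^ 2 +
  e * Cmod (z0 + z) ^ 2 <= Cmod (g z0) ^ 2 + e * Cmod z0 ^ 2).
{ intros z Hz. apply Rnot_lt_le. intros Hlt. apply Hno.
  exists (z0 + z)%C. split; [|exact Hlt].
  replace (z0 + z - z0)%C with z by ring. lra. }
assert (U1 := Hall _ M1). assert (U2 := Hall _ M2).
assert (U3 := Hall _ M3). assert (U4 := Hall _ M4).
rewrite E0 in U1, U2, U3, U4.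
assert (S1 : 0 <= Cmod c1 ^ 2 * t ^ 2)
  by (apply Rmult_le_pos; apply pow2_ge_0).
assert (S2 : 0 <= Cmod c2 ^ 2 * t ^ 4)
  by (apply Rmult_le_pos; [apply pow2_ge_0|apply pow_le; lra]).
assert (S3 : 2 * (M * K) * t ^ 3 < e * t ^ 2).
{ replace (2 * (M * K) * t ^ 3) with (2 * (M * K) * t * t ^ 2) by ring.
  apply Rmult_lt_compat_r; [apply pow_lt; lra|exact Hsmall]. }
apply (f_equal (Rmult e)) in Hid. lra.
Qed.

(** Compactness of the closed disc, in a form that serves both to bound a
    continuous function and to show that it attains its supremum: [Q d z] is a
    property that weakens as [d] decreases. *)
Lemma disc_local_to_uniform (rho : R) (Q : R -> C -> Prop) :
  (forall d1 d2 z, 0 < d1 <= d2 -> Q d2 z -> Q d1 z) ->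
  (forall p, Cmod p <= rho -> exists d, 0 < d /\
     forall z, Cmod z <= rho -> Cmod (z - p) < d -> Q d z) ->
  exists d, 0 < d /\ forall z, Cmod z <= rho -> Q d z.
Proof.
intros Hmono Hloc.
assert (Hall : forall p : C, exists d : posreal,
  forall z, Cmod z <= rho -> Cmod (z - p) < 2 * d -> Q d z).
{ intros p. destruct (Rle_dec (Cmod p) rho) as [Hp|Hp].
  - destruct (Hloc p Hp) as [d [Hd H]].
    exists (mkposreal (d / 2) ltac:(lra)). simpl. intros z Hz Hzp.
    apply (Hmono _ d); [lra|]. apply H; [exact Hz|lra].
  (* The compactness theorem is about a square: around its points outside the
     disc, take a neighbourhood that misses the disc. *)
  - exists (mkposreal ((Cmod p - rho) / 2) ltac:(lra)). simpl. intros z Hz Hzp.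
    exfalso. assert (T := Cmod_triangle (- (z - p)) z).
    rewrite Cmod_opp in T. replace (- (z - p) + z)%C with p in T by ring. lra. }
(* The factor 2 absorbs the comparison of the modulus with the maximum norm,
   for which the neighbourhoods of the compactness theorem are squares. *)
set (delta x y := proj1_sig (constructive_indefinite_description _ (Hall (x, y)))).
assert (Hdelta : forall x y z, Cmod z <= rho ->
  Cmod (z - (x, y)) < 2 * delta x y -> Q (delta x y) z).
{ intros x y. unfold delta. now destruct constructive_indefinite_description. }
destruct (compactness_value_2d (- rho) rho (- rho) rho delta) as [d Hd].
exists d. split; [apply cond_pos|].
intros z Hz. apply NNPP. intros Hno.
assert (Hx := Rmax_Cmod z).
assert (Hx1 := Rle_trans _ _ _ (Rmax_l _ _) (Rle_trans _ _ _ Hx Hz)).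
assert (Hx2 := Rle_trans _ _ _ (Rmax_r _ _) (Rle_trans _ _ _ Hx Hz)).
apply Rabs_le_between in Hx1. apply Rabs_le_between in Hx2.
apply (Hd (fst z) (snd z) Hx1 Hx2).
intros (x & y & _ & _ & H1 & H2 & H3). apply Hno.
apply (Hmono _ (delta x y)); [split; [apply cond_pos|exact H3]|].
apply Hdelta; [exact Hz|].
eapply Rle_lt_trans; [apply Cmod_2Rmax|].
simpl fst; simpl snd.
change (fst z + - x) with (fst z - x). change (snd z + - y) with (snd z - y).
assert (Hm : Rmax (Rabs (fst z - x)) (Rabs (snd z - y)) < delta x y)
  by now apply Rmax_lub_lt.
assert (Hs : sqrt 2 <= 2).
{ rewrite <- (sqrt_square 2) at 2 by lra. apply sqrt_le_1_alt. lra. }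
assert (0 <= Rmax (Rabs (fst z - x)) (Rabs (snd z - y)))
  by (eapply Rle_trans; [apply Rabs_pos|apply Rmax_l]).
nra.
Qed.

Lemma disc_attains_max (rho : R) (u : C -> R) :
  0 <= rho ->
  (forall p, Cmod p <= rho -> forall e, 0 < e -> exists d, 0 < d /\
     forall z, Cmod z <= rho -> Cmod (z - p) < d -> Rabs (u z - u p) < e) ->
  exists p, Cmod p <= rho /\ forall z, Cmod z <= rho -> u z <= u p.
Proof.
intros Hrho Hc.
destruct (disc_local_to_uniform rho (fun d z => u z <= / d)) as [d [Hd Hbd]].
{ intros d1 d2 z H12 H. eapply Rle_trans; [apply H|].
  apply Rinv_le_contravar; lra. }
{ intros p Hp. destruct (Hc p Hp 1 Rlt_0_1) as [d [Hd H]].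
  assert (Ha := Rabs_pos (u p)).
  exists (Rmin d (/ (Rabs (u p) + 1))). split.
  - apply Rmin_pos; [exact Hd|]. apply Rinv_0_lt_compat. lra.
  - intros z Hz Hzp.
    assert (H1 := H z Hz (Rlt_le_trans _ _ _ Hzp (Rmin_l _ _))).
    apply Rabs_lt_between in H1. assert (Hl := Rle_abs (u p)).
    apply Rle_trans with (/ / (Rabs (u p) + 1)).
    + rewrite Rinv_inv. lra.
    + apply Rinv_le_contravar; [|apply Rmin_r].
      apply Rmin_pos; [exact Hd|]. apply Rinv_0_lt_compat. lra. }
destruct (completeness (fun y => exists z, Cmod z <= rho /\ y = u z))
  as [s [Hub Hlub]].
{ exists (/ d). intros y [z [Hz ->]]. now apply Hbd. }
{ exists (u 0%C), 0%C. split; [rewrite Cmod_0; lra|reflexivity]. }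
assert (Hle : forall z, Cmod z <= rho -> u z <= s)
  by (intros z Hz; apply Hub; now exists z).
apply NNPP. intros Hno.
assert (Hlt : forall z, Cmod z <= rho -> u z < s).
{ intros z Hz. destruct (Hle z Hz) as [H|H]; [exact H|].
  exfalso. apply Hno. exists z. split; [exact Hz|].
  intros w Hw. rewrite H. now apply Hle. }
destruct (disc_local_to_uniform rho (fun d z => u z <= s - d)) as [d' [Hd' H]].
{ intros d1 d2 z H12 H. lra. }
{ intros p Hp. assert (Hp' := Hlt p Hp).
  destruct (Hc p Hp ((s - u p) / 2) ltac:(lra)) as [d1 [Hd1 H]].
  exists (Rmin d1 ((s - u p) / 2)). split; [apply Rmin_pos; lra|].
  intros z Hz Hzp.
  assert (H1 := H z Hz (Rlt_le_trans _ _ _ Hzp (Rmin_l _ _))).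
  apply Rabs_lt_between in H1.
  assert (H2 := Rmin_r d1 ((s - u p) / 2)). lra. }
assert (s <= s - d'); [|lra].
apply Hlub. intros y [z [Hz ->]]. now apply H.
Qed.

(** For every [e > 0] the perturbed function |g|^2 + e |z|^2 attains its maximum
    over the closed disc, and only on the boundary; let [e] tend to 0. *)
Lemma maximum_modulus (g : C -> C) (rho m : R) :
  0 <= rho -> 0 <= m ->
  (forall z, Cmod z <= rho -> taylor2 g z) ->
  (forall z, Cmod z = rho -> Cmod (g z) <= m) ->
  forall z, Cmod z <= rho -> Cmod (g z) <= m.
Proof.
intros Hrho Hm Hg Hb z Hz.
assert (Heps : forall e, 0 < e -> Cmod (g z) ^ 2 <= m ^ 2 + e * rho ^ 2).
{ intros e He.
  destruct (disc_attains_max rho (fun z => Cmod (g z) ^ 2 + e * Cmod z ^ 2) Hrho)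
    as [p [Hp Hmax]].
  { intros p Hp eta Heta.
    destruct (taylor2_continuous g p (Hg p Hp)) as (K & d & Hd & HK & HL).
    set (N := K * (2 * Cmod (g p) + K) + e * (2 * Cmod p + 1)).
    assert (G0 := Cmod_ge_0 (g p)). assert (G1 := Cmod_ge_0 p).
    assert (HN : 0 <= N) by (unfold N; nra).
    exists (Rmin (Rmin d 1) (eta / (N + 1))).
    assert (Hq : 0 < eta / (N + 1)) by (apply Rdiv_lt_0_compat; lra).
    split; [repeat apply Rmin_pos; lra|].
    intros w Hw Hwp.
    assert (W1 : Cmod (w - p) < d)
      by (eapply Rlt_le_trans; [apply Hwp|];
          eapply Rle_trans; [apply Rmin_l|apply Rmin_l]).
    assert (W2 : Cmod (w - p) < 1)
      by (eapply Rlt_le_trans; [apply Hwp|];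
          eapply Rle_trans; [apply Rmin_l|apply Rmin_r]).
    assert (W3 : Cmod (w - p) < eta / (N + 1))
      by (eapply Rlt_le_trans; [apply Hwp|apply Rmin_r]).
    assert (W4 : Cmod (w - p) * (N + 1) < eta).
    { apply (Rmult_lt_compat_r (N + 1)) in W3; [|lra].
      unfold Rdiv in W3. rewrite Rmult_assoc, Rinv_l, Rmult_1_r in W3 by lra.
      exact W3. }
    assert (W0 := Cmod_ge_0 (w - p)). set (x := Cmod (w - p)) in *.
    assert (D : forall a c : C, Rabs (Cmod a ^ 2 - Cmod c ^ 2) <=
      Cmod (a - c) * (2 * Cmod c + Cmod (a - c))).
    { intros a c.
      assert (T1 := Cmod_triangle (a - c) c).
      replace (a - c + c)%C with a in T1 by ring.
      assert (T2 := Cmod_triangle (- (a - c)) a). rewrite Cmod_opp in T2.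
      replace (- (a - c) + a)%C with c in T2 by ring.
      assert (T3 := Cmod_ge_0 (a - c)). assert (T4 := Cmod_ge_0 a).
      assert (T5 := Cmod_ge_0 c).
      apply Rabs_le. split; simpl; nra. }
    assert (D1 := D (g w) (g p)). assert (D2 := D w p). fold x in D2.
    assert (HLw := HL w W1). fold x in HLw.
    assert (G3 := Cmod_ge_0 (g w - g p)).
    assert (D3 : Rabs (Cmod (g w) ^ 2 - Cmod (g p) ^ 2) <=
      x * (K * (2 * Cmod (g p) + K))).
    { eapply Rle_trans; [apply D1|].
      assert (Cmod (g w - g p) <= K) by nra.
      replace (x * (K * (2 * Cmod (g p) + K)))
        with (K * x * (2 * Cmod (g p) + K)) by ring.
      apply Rmult_le_compat; lra. }
    assert (D4 : Rabs (Cmod w ^ 2 - Cmod p ^ 2) <= x * (2 * Cmod p + 1)).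
    { eapply Rle_trans; [apply D2|]. nra. }
    replace (Cmod (g w) ^ 2 + e * Cmod w ^ 2 - (Cmod (g p) ^ 2 + e * Cmod p ^ 2))
      with ((Cmod (g w) ^ 2 - Cmod (g p) ^ 2) + e * (Cmod w ^ 2 - Cmod p ^ 2))
      by ring.
    eapply Rle_lt_trans; [apply Rabs_triang|].
    rewrite Rabs_mult, (Rabs_pos_eq e) by lra.
    apply (Rmult_le_compat_l e) in D4; [|lra].
    unfold N in W4. nra. }
  assert (Hpr : Cmod p = rho).
  { destruct Hp as [Hp|Hp]; [exfalso|exact Hp].
    destruct (perturbed_modulus_no_local_max g p e (rho - Cmod p))
      as [w [Hw Hlt]]; [apply Hg; lra|exact He|lra|].
    assert (T := Cmod_triangle (w - p) p).
    replace (w - p + p)%C with w in T by ring.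
    assert (Hw' := Hmax w ltac:(lra)). cbv beta in Hw'. lra. }
  assert (H := Hmax z Hz). cbv beta in H.
  assert (H1 : Cmod (g p) ^ 2 <= m ^ 2)
    by (apply pow_incr; split; [apply Cmod_ge_0|now apply Hb]).
  rewrite Hpr in H.
  assert (0 <= e * Cmod z ^ 2)
    by (apply Rmult_le_pos; [lra|apply pow2_ge_0]).
  lra. }
assert (Hsq : Cmod (g z) ^ 2 <= m ^ 2).
{ apply le_epsilon. intros e He.
  assert (Hr : 0 < rho ^ 2 + 1) by (assert (H := pow2_ge_0 rho); lra).
  assert (H := Heps (e / (rho ^ 2 + 1)) ltac:(now apply Rdiv_lt_0_compat)).
  assert (Hq : 0 < e / (rho ^ 2 + 1)) by now apply Rdiv_lt_0_compat.
  assert (e / (rho ^ 2 + 1) * (rho ^ 2 + 1) = e) by (field; lra).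
  lra. }
apply Rsqr_incr_0; [|apply Cmod_ge_0|exact Hm].
now rewrite !Rsqr_pow2.
Qed.

(** The maximum principle for [w z / z], extended to 0 by the derivative, on
    the discs of radius [rho], as [rho] tends to 1. *)
Lemma schwarz (w : C -> C) :
  Omega w -> forall z : C, unit_disc z -> Cmod (w z) <= Cmod z.
Proof.
intros (Han & Hw0 & Hlt).
assert (H00 : unit_disc 0%C) by (unfold unit_disc; rewrite Cmod_0; lra).
assert (Hser : forall z0, unit_disc z0 -> exists a r, 0 < r /\
  local_series a r (fun z => w (z0 + z)%C)).
{ intros z0 Hz0. destruct (Han z0 Hz0) as (a & r & Hr & H).
  exists a, r. split; [exact Hr|]. intros z Hz.
  specialize (H (z0 + z)%C).
  replace (z0 + z - z0)%C with z in H by ring. now apply H. }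
destruct (Hser 0%C H00) as (a & r & Hr & Ha).
destruct (local_series_shift _ _ _ Hr Ha) as [g0 [Hg0 E0]].
assert (Ha0 : a 0%nat = 0%C).
{ rewrite <- (local_series_center _ _ _ Hr Ha).
  now rewrite Cplus_0_l. }
set (g z := if Ceq_dec z 0%C then g0 0%C else (w z / z)%C).
assert (Hg : forall z, unit_disc z -> taylor2 g z).
{ intros z0 Hz0. destruct (Ceq_dec z0 0%C) as [->|Hne].
  - apply (taylor2_ext_loc g0 g 0%C r Hr).
    + intros z Hz. rewrite Cplus_0_l.
      unfold g. destruct (Ceq_dec z 0%C) as [->|Hz1]; [reflexivity|].
      specialize (E0 z Hz). cbv beta in E0.
      rewrite Cplus_0_l in E0.
      rewrite E0, Ha0. field. exact Hz1.
    + apply (local_series_taylor2 (PS_decr_1 a) r); [exact Hr|].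
      intros z Hz. rewrite Cplus_0_l. now apply Hg0.
  - apply (taylor2_ext_loc (fun z => w z / z)%C g z0 (Cmod z0)).
    + now apply Cmod_gt_0.
    + intros z Hz. unfold g.
      destruct (Ceq_dec (z0 + z)%C 0%C) as [Hz1|Hz1]; [exfalso|reflexivity].
      assert (z0 = - z)%C as Ez by (replace z0 with ((z0 + z) - z)%C by ring; rewrite Hz1; ring).
      rewrite Ez, Cmod_opp in Hz. lra.
    + apply taylor2_div_id; [exact Hne|].
      destruct (Hser z0 Hz0) as (b & s & Hs & Hb).
      now apply (local_series_taylor2 b s). }
intros z Hz. unfold unit_disc in Hz.
destruct (Ceq_dec z 0%C) as [->|Hne]; [rewrite Hw0; lra|].
assert (Hzp : 0 < Cmod z) by now apply Cmod_gt_0.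
assert (Hrho : forall rho, Cmod z <= rho < 1 -> Cmod (w z) * rho <= Cmod z).
{ intros rho Hr1.
  assert (Hq : Cmod (g z) <= / rho).
  { apply (maximum_modulus g rho); try lra.
    - left. apply Rinv_0_lt_compat. lra.
    - intros y Hy. apply Hg. unfold unit_disc. lra.
    - intros y Hy. unfold g.
      assert (Hy0 : y <> 0%C) by (apply Cmod_gt_0; lra).
      destruct (Ceq_dec y 0%C) as [Hy1|_]; [contradiction|].
      rewrite Cmod_div, Hy by exact Hy0.
      assert (Hy1 := Hlt y ltac:(unfold unit_disc; lra)).
      unfold Rdiv. rewrite <- (Rmult_1_l (/ rho)) at 2.
      apply Rmult_le_compat_r; [|lra].
      left. apply Rinv_0_lt_compat. lra. }
  unfold g in Hq. destruct (Ceq_dec z 0%C) as [Hz1|_]; [contradiction|].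
  rewrite Cmod_div in Hq by exact Hne.
  apply (Rmult_le_compat_r (Cmod z * rho)) in Hq; [|nra].
  replace (Cmod (w z) / Cmod z * (Cmod z * rho)) with (Cmod (w z) * rho) in Hq
    by (field; lra).
  replace (/ rho * (Cmod z * rho)) with (Cmod z) in Hq by (field; lra).
  exact Hq. }
apply Rnot_lt_le. intros Hc.
(* The midpoint of |z| / |w z| and 1 is a radius in [|z|, 1) at which Hrho fails. *)
assert (Hwp := Hlt z Hz).
assert (H := Hrho ((1 + Cmod z / Cmod (w z)) / 2)).
assert (Hq : Cmod z / Cmod (w z) < 1).
{ apply Rmult_lt_reg_r with (Cmod (w z)); [lra|].
  unfold Rdiv. rewrite Rmult_assoc, Rinv_l by lra. lra. }
assert (Hq2 : Cmod z <= Cmod z / Cmod (w z)).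
{ apply Rmult_le_reg_r with (Cmod (w z)); [lra|].
  unfold Rdiv. rewrite Rmult_assoc, Rinv_l by lra. nra. }
specialize (H ltac:(lra)).
assert (Cmod (w z) * (Cmod z / Cmod (w z)) = Cmod z) by (field; lra).
nra.
Qed.


(** * Limits and derivatives from local power series *)

Lemma C_lim_lipschitz (f : C -> C) (z l : C) (K d : R) :
  0 < d ->
  (forall x, x <> z -> Cmod (x - z) < d -> Cmod (f x - l) <= K * Cmod (x - z)) ->
  C_lim f z = l.
Proof.
intros Hd H. apply is_C_lim_unique. apply filterlim_locally. intros eps.
set (K' := Rabs K + 1).
assert (HK : 0 < K') by (unfold K'; assert (T := Rabs_pos K); lra).
assert (Heps := cond_pos eps).
assert (Hm : 0 < Rmin d (eps / K') / 2).
{ assert (0 < Rmin d (eps / K'))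
    by (apply Rmin_pos; [exact Hd|now apply Rdiv_lt_0_compat]). lra. }
exists (mkposreal _ Hm). intros x Hx Hne.
apply C_NormedModule_mixin_compat1. change (Cmod (f x - l) < eps).
apply C_NormedModule_mixin_compat2 in Hx. simpl in Hx.
change (minus x z) with (x - z)%C in Hx.
assert (Hs : sqrt 2 <= 2).
{ rewrite <- (sqrt_square 2) at 2 by lra. apply sqrt_le_1_alt. lra. }
assert (Hx' : Cmod (x - z) < Rmin d (eps / K')) by nra.
assert (Hxd := Rlt_le_trans _ _ _ Hx' (Rmin_l _ _)).
assert (Hxe := Rlt_le_trans _ _ _ Hx' (Rmin_r _ _)).
eapply Rle_lt_trans; [apply H; assumption|].
assert (H0 := Cmod_ge_0 (x - z)).
apply (Rmult_lt_compat_r K') in Hxe; [|exact HK].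
replace (eps / K' * K') with (pos eps) in Hxe by (field; lra).
assert (T := Rle_abs K). unfold K' in Hxe. nra.
Qed.

Lemma C_derive_local_series (a : nat -> C) (r : R) (f : C -> C) (z : C) :
  0 < r -> local_series a r (fun w => f (z + w)%C) -> C_derive f z = a 1%nat.
Proof.
intros Hr Ha.
destruct (local_series_shift _ _ _ Hr Ha) as [g1 [Hg1 E1]].
destruct (local_series_shift _ _ _ Hr Hg1) as [g2 [Hg2 E2]].
destruct (local_series_bounded _ _ _ Hr Hg2) as [K [d [Hd HK]]].
assert (E0 := local_series_center _ _ _ Hr Ha). cbv beta in E0.
rewrite Cplus_0_r in E0.
unfold C_derive. apply (C_lim_lipschitz _ _ _ K d); [lra|].
intros x Hx Hxz.
assert (Hne : (x - z)%C <> 0%C).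
{ intros H. apply Hx. replace x with (x - z + z)%C by ring. rewrite H. ring. }
assert (E := E1 (x - z)%C ltac:(lra)). cbv beta in E.
rewrite E2 in E by lra.
replace (z + (x - z))%C with x in E by ring.
rewrite E, E0.
replace ((a 0%nat + (x - z) * (PS_decr_1 a 0%nat + (x - z) * g2 (x - z)) -
  a 0%nat) / (x - z) - a 1%nat)%C with (g2 (x - z) * (x - z))%C
  by (unfold PS_decr_1; field; exact Hne).
rewrite Cmod_mult. apply Rmult_le_compat_r; [apply Cmod_ge_0|now apply HK].
Qed.

Lemma is_series_C (a : nat -> C) (l : C) :
  is_series (fun n => Re (a n)) (Re l) -> is_series (fun n => Im (a n)) (Im l) ->
  @is_series C_AbsRing C_NormedModule a l.
Proof.
intros H1 H2.
assert (Hsum : forall n, @sum_n C_AbelianMonoid a n =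
  (sum_n (fun n => Re (a n)) n, sum_n (fun n => Im (a n)) n)).
{ induction n as [|n IH].
  - rewrite !sum_O. unfold Re, Im. now destruct (a 0%nat).
  - rewrite !sum_Sn, IH. reflexivity. }
apply (filterlim_locally (U := C_UniformSpace)). intros eps.
assert (B1 := proj1 (filterlim_locally _ _) H1 eps).
assert (B2 := proj1 (filterlim_locally _ _) H2 eps).
generalize (filter_and _ _ B1 B2). apply filter_imp.
intros n [Hn1 Hn2].
change (ball (M := C_UniformSpace) l eps (@sum_n C_AbelianMonoid a n)).
rewrite Hsum. now split.
Qed.

(** * Power series solutions of (u + v z) F' = k F *)

(** The Taylor coefficients at 0 of the solution of (u + v z) F' = k F with
    F(0) = f0. The powers (1 + B z)^c and the exponential both solve such an
    equation, with [v = 0] for the latter, so they need no separate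
    treatment. *)
Fixpoint ode_coeff (u v k f0 : C) (n : nat) : C :=
  match n with
  | O => f0
  | S m => ((k - INR m * v) * ode_coeff u v k f0 m / (INR (S m) * u))%C
  end.

Lemma ode_coeff_S (u v k f0 : C) (n : nat) :
  ode_coeff u v k f0 (S n) =
  ((k - INR n * v) * ode_coeff u v k f0 n / (INR (S n) * u))%C.
Proof. reflexivity. Qed.

Lemma eventual_ratio_bound (q : R) (N : nat) (x : nat -> R) :
  0 < q -> (forall n, (N <= n)%nat -> x (S n) <= q * x n) ->
  exists M, forall n, x n <= M * q ^ n.
Proof.
intros Hq. revert x. induction N as [|N IH]; intros x H.
- exists (x 0%nat). induction n as [|n IHn].
  + rewrite pow_O. lra.
  + eapply Rle_trans; [apply H; lia|]. rewrite <- tech_pow_Rmult. nra.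
- destruct (IH (fun n => x (S n))) as [M HM].
  { intros n Hn. apply H. lia. }
  (* The induction hypothesis is about the sequence shifted by one. *)
  exists (Rmax (x 0%nat) (M / q)). intros [|n].
  + rewrite pow_O, Rmult_1_r. apply Rmax_l.
  + eapply Rle_trans; [apply HM|].
    replace (M * q ^ n) with (M / q * q ^ S n) by (simpl; field; lra).
    apply Rmult_le_compat_r; [apply pow_le; lra|apply Rmax_r].
Qed.

Lemma INR_C_neq_0 (n : nat) : RtoC (INR (S n)) <> 0%C.
Proof. intros H. apply RtoC_inj in H. now apply (not_0_INR (S n)) in H. Qed.

(** The ratio of consecutive coefficients tends to |v| / |u| < 1 in modulus, so
    it is eventually at most the midpoint of |v| / |u| and 1. *)
Lemma ode_coeff_geometric_bound (u v k f0 : C) :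
  Cmod v < Cmod u ->
  exists M q, 0 < q < 1 /\ forall n, Cmod (ode_coeff u v k f0 n) <= M * q ^ n.
Proof.
intros Hvu. assert (Hv := Cmod_ge_0 v). assert (Hu : 0 < Cmod u) by lra.
assert (Hk := Cmod_ge_0 k).
assert (Hune : u <> 0%C) by now apply Cmod_gt_0.
set (q := (Cmod v / Cmod u + 1) / 2).
assert (Hqv : q * Cmod u = (Cmod v + Cmod u) / 2) by (unfold q; field; lra).
assert (Hq : 0 < q < 1) by (split; nra).
destruct (INR_archimed ((Cmod u - Cmod v) / 2) (Cmod k)) as [N HN]; [lra|].
destruct (eventual_ratio_bound q N (fun n => Cmod (ode_coeff u v k f0 n)))
  as [M HM].
- tauto.
- intros n Hn. rewrite ode_coeff_S.
  rewrite Cmod_div, !Cmod_mult.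
  2: { apply Cmult_neq_0; [apply INR_C_neq_0|exact Hune]. }
  rewrite (Cmod_R (INR (S n))), (Rabs_pos_eq (INR (S n))) by apply pos_INR.
  assert (Hnn : INR N <= INR n) by now apply le_INR.
  assert (Hn0 := pos_INR n).
  assert (Hc : Cmod (k - INR n * v) <= q * (INR (S n) * Cmod u)).
  { eapply Rle_trans; [apply Cmod_triangle|].
    rewrite Cmod_opp, Cmod_mult, Cmod_R, Rabs_pos_eq by exact Hn0.
    rewrite S_INR. nra. }
  assert (Hp : 0 < INR (S n) * Cmod u)
    by (apply Rmult_lt_0_compat; [apply lt_0_INR; lia|exact Hu]).
  apply Rmult_le_reg_r with (INR (S n) * Cmod u); [exact Hp|].
  unfold Rdiv. rewrite Rmult_assoc, Rinv_l, Rmult_1_r by lra.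
  assert (T := Cmod_ge_0 (ode_coeff u v k f0 n)). nra.
- exists M, q. now split.
Qed.

Lemma CV_radius_gt_1 (p : nat -> R) (M q : R) :
  0 < q < 1 -> (forall n, Rabs (p n) <= M * q ^ n) -> Rbar_lt 1 (CV_radius p).
Proof.
intros Hq H. apply Rbar_lt_le_trans with (/ q).
- simpl. rewrite <- Rinv_1. apply Rinv_lt_contravar; lra.
- apply (proj1 (CV_radius_bounded p)). exists M. intros n.
  rewrite Rabs_mult, pow_inv, (Rabs_pos_eq (/ _)).
  2: { left. apply Rinv_0_lt_compat, pow_lt. lra. }
  assert (Hp : 0 < q ^ n) by (apply pow_lt; lra).
  apply Rmult_le_reg_r with (q ^ n); [exact Hp|].
  rewrite Rmult_assoc, Rinv_l, Rmult_1_r by lra. apply H.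
Qed.

(** The real part of (u + t v) G' = k G for G = P + i Q. The imaginary part is
    the same statement with [q], [p] for [p], [q] and the signs of [u2], [v2],
    [k2] changed. *)
Lemma pseries_ode_re (p q : nat -> R) (u1 u2 v1 v2 k1 k2 t : R) :
  Rbar_lt (Rabs t) (CV_radius p) -> Rbar_lt (Rabs t) (CV_radius q) ->
  (forall n, u1 * (INR (S n) * p (S n)) - u2 * (INR (S n) * q (S n)) +
     (v1 * (INR n * p n) - v2 * (INR n * q n)) = k1 * p n - k2 * q n) ->
  u1 * PSeries (PS_derive p) t - u2 * PSeries (PS_derive q) t +
  t * (v1 * PSeries (PS_derive p) t - v2 * PSeries (PS_derive q) t) =
  k1 * PSeries p t - k2 * PSeries q t.
Proof.
intros Hp Hq H.
assert (Ip := PSeries_correct p t (CV_radius_inside p t Hp)).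
assert (Iq := PSeries_correct q t (CV_radius_inside q t Hq)).
assert (Dp := PSeries_correct (PS_derive p) t
  (CV_radius_inside (PS_derive p) t ltac:(now rewrite CV_radius_derive))).
assert (Dq := PSeries_correct (PS_derive q) t
  (CV_radius_inside (PS_derive q) t ltac:(now rewrite CV_radius_derive))).
assert (Sc : forall (c : R) a l, is_pseries a t l ->
  is_pseries (PS_scal c a) t (c * l)).
{ intros c a l Hl. apply (is_pseries_scal c a t l); [apply Rmult_comm|exact Hl]. }
assert (L := is_pseries_plus _ _ t _ _
  (is_pseries_plus _ _ t _ _ (Sc u1 _ _ Dp) (Sc (- u2) _ _ Dq))
  (is_pseries_incr_1 _ t _
    (is_pseries_plus _ _ t _ _ (Sc v1 _ _ Dp) (Sc (- v2) _ _ Dq)))).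
assert (L' := is_pseries_plus _ _ t _ _ (Sc k1 _ _ Ip) (Sc (- k2) _ _ Iq)).
apply is_pseries_unique in L. apply is_pseries_unique in L'.
match type of L with PSeries ?a _ = ?x =>
match type of L' with PSeries ?b _ = ?y =>
  assert (E : x = y) end end.
{ rewrite <- L, <- L'. apply PSeries_ext. intros n. specialize (H n).
  unfold PS_plus, PS_scal, PS_incr_1, PS_derive.
  destruct n as [|n]; unfold plus, scal, zero; simpl AbelianMonoid.plus;
  simpl in H |- *; unfold mult; simpl in H |- *; lra. }
unfold plus, scal in E; simpl in E. unfold mult in E; simpl in E. lra.
Qed.

(** Derivative of a complex function of a real variable. Comparing functions
    along rays with real derivatives only allows real power series and real
    calculus to do the work of complex differentiation. *)
Definition is_derive_path (l : R -> C) (t : R) (d : C) : Prop :=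
  is_derive (fun s => Re (l s)) t (Re d) /\
  is_derive (fun s => Im (l s)) t (Im d).

(** If G' = l' G, where G = P + i Q, then G exp(-l) has zero derivative, hence
    is constant. *)
Lemma Cexp_ode_unique (P Q P' Q' : R -> R) (l l' : R -> C) :
  (forall t, 0 <= t <= 1 -> is_derive P t (P' t) /\ is_derive Q t (Q' t)) ->
  (forall t, 0 <= t <= 1 -> is_derive_path l t (l' t)) ->
  (forall t, 0 <= t <= 1 ->
     ((P' t, Q' t) : C) = ((P t, Q t) * l' t)%C) ->
  ((P 0, Q 0) : C) = Cexp (l 0) -> ((P 1, Q 1) : C) = Cexp (l 1).
Proof.
intros HD Hl HE H0.
(* X + i Y = G exp(-l). *)
set (l1 t := Re (l t)). set (l2 t := Im (l t)).
set (X t := exp (- l1 t) * (P t * cos (l2 t) + Q t * sin (l2 t))).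
set (Y t := exp (- l1 t) * (Q t * cos (l2 t) - P t * sin (l2 t))).
assert (HX : X 0 = X 1).
{ apply (eq_is_derive X 0 1); [|lra]. intros t Ht.
  destruct (HD t Ht) as [DP DQ]. destruct (Hl t Ht) as [D1 D2].
  assert (E := HE t Ht). apply pair_equal_spec in E. destruct E as [E1 E2].
  change (is_derive l1 t (Re (l' t))) in D1.
  change (is_derive l2 t (Im (l' t))) in D2. clearbody l1 l2. change (is_derive X t 0).
  unfold X. auto_derive.
  - repeat (split; [eexists; first [exact D1 | exact D2 | exact DP | exact DQ]|]).
    exact I.
  - replace (Derive (fun x : R => P x) t) with (P' t)
      by (symmetry; apply is_derive_unique, DP).
    replace (Derive (fun x : R => Q x) t) with (Q' t)
      by (symmetry; apply is_derive_unique, DQ).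
    replace (Derive (fun x : R => l1 x) t) with (Re (l' t))
      by (symmetry; apply is_derive_unique, D1).
    replace (Derive (fun x : R => l2 x) t) with (Im (l' t))
      by (symmetry; apply is_derive_unique, D2).
    rewrite E1, E2. unfold Re, Im; simpl. ring. }
assert (HY : Y 0 = Y 1).
{ apply (eq_is_derive Y 0 1); [|lra]. intros t Ht.
  destruct (HD t Ht) as [DP DQ]. destruct (Hl t Ht) as [D1 D2].
  assert (E := HE t Ht). apply pair_equal_spec in E. destruct E as [E1 E2].
  change (is_derive l1 t (Re (l' t))) in D1.
  change (is_derive l2 t (Im (l' t))) in D2. clearbody l1 l2. change (is_derive Y t 0).
  unfold Y. auto_derive.
  - repeat (split; [eexists; first [exact D1 | exact D2 | exact DP | exact DQ]|]).
    exact I.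
  - replace (Derive (fun x : R => P x) t) with (P' t)
      by (symmetry; apply is_derive_unique, DP).
    replace (Derive (fun x : R => Q x) t) with (Q' t)
      by (symmetry; apply is_derive_unique, DQ).
    replace (Derive (fun x : R => l1 x) t) with (Re (l' t))
      by (symmetry; apply is_derive_unique, D1).
    replace (Derive (fun x : R => l2 x) t) with (Im (l' t))
      by (symmetry; apply is_derive_unique, D2).
    rewrite E1, E2. unfold Re, Im; simpl. ring. }
apply pair_equal_spec in H0. destruct H0 as [P0 Q0].
fold (l1 0) (l2 0) in P0, Q0.
assert (T0 := sin2_cos2 (l2 0)). assert (T1 := sin2_cos2 (l2 1)).
unfold Rsqr in T0, T1.
assert (X0 : X 0 = 1).
{ unfold X. rewrite P0, Q0, exp_Ropp.
  assert (Hne := Rgt_not_eq _ _ (exp_pos (l1 0))).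
  transitivity (sin (l2 0) * sin (l2 0) + cos (l2 0) * cos (l2 0));
    [field; exact Hne|exact T0]. }
assert (Y0 : Y 0 = 0) by (unfold Y; rewrite P0, Q0; ring).
rewrite X0 in HX. rewrite Y0 in HY.
set (e := exp (l1 1)).
assert (He : exp (- l1 1) * e = 1)
  by (unfold e; rewrite <- exp_plus, Rplus_opp_l; apply exp_0).
set (c := cos (l2 1)) in *. set (s := sin (l2 1)) in *.
assert (A1 : P 1 * c + Q 1 * s = e).
{ transitivity (exp (- l1 1) * e * (P 1 * c + Q 1 * s));
    [rewrite He; ring|].
  transitivity (e * X 1); [unfold X; fold c s; ring|]. rewrite <- HX. ring. }
assert (A2 : Q 1 * c - P 1 * s = 0).
{ transitivity (exp (- l1 1) * e * (Q 1 * c - P 1 * s));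
    [rewrite He; ring|].
  transitivity (e * Y 1); [unfold Y; fold c s; ring|]. rewrite <- HY. ring. }
unfold Cexp. fold (l1 1) (l2 1). fold e c s. apply pair_equal_spec. split.
- transitivity (c * (P 1 * c + Q 1 * s) - s * (Q 1 * c - P 1 * s)).
  + transitivity (P 1 * (s * s + c * c)); [rewrite T1; ring|ring].
  + rewrite A1, A2. ring.
- transitivity (s * (P 1 * c + Q 1 * s) + c * (Q 1 * c - P 1 * s)).
  + transitivity (Q 1 * (s * s + c * c)); [rewrite T1; ring|ring].
  + rewrite A1, A2. ring.
Qed.

Lemma C_eq_of_mult_eq (a b c d : C) :
  a <> 0%C -> (a * b)%C = (c * d)%C -> b = (d * (c / a))%C.
Proof.
intros Ha H. transitivity (a * b / a)%C; [field; exact Ha|].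
rewrite H. field. exact Ha.
Qed.

(** The series G(t) with coefficients [ode_coeff] has radius of convergence
    greater than 1, and both G and exp(l) solve (u + t v) y' = k y with the same
    value at 0. They agree at [t = 1]. *)
Lemma ode_series (u v k : C) (l : R -> C) :
  Cmod v < Cmod u ->
  (forall t, 0 <= t <= 1 -> is_derive_path l t (k / (u + t * v))%C) ->
  @is_series C_AbsRing C_NormedModule (ode_coeff u v k (Cexp (l 0)))
    (Cexp (l 1)).
Proof.
intros Hvu Hl. assert (Hv := Cmod_ge_0 v).
assert (Hune : u <> 0%C) by (apply Cmod_gt_0; lra).
set (h := ode_coeff u v k (Cexp (l 0))).
destruct (ode_coeff_geometric_bound u v k (Cexp (l 0)) Hvu) as (M & q & Hq & HM).
fold h in HM.
assert (Hrp : Rbar_lt 1 (CV_radius (fun n => Re (h n)))).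
{ apply (CV_radius_gt_1 _ M q Hq). intros n.
  eapply Rle_trans; [apply re_le_Cmod|apply HM]. }
assert (Hrq : Rbar_lt 1 (CV_radius (fun n => Im (h n)))).
{ apply (CV_radius_gt_1 _ M q Hq). intros n.
  eapply Rle_trans; [|apply HM].
  eapply Rle_trans; [|apply Rmax_Cmod]. apply Rmax_r. }
set (p := fun n => Re (h n)) in *. set (r := fun n => Im (h n)) in *.
assert (Hin : forall t a, 0 <= t <= 1 -> Rbar_lt 1 (CV_radius a) ->
  Rbar_lt (Rabs t) (CV_radius a)).
{ intros t a Ht Ha. apply Rbar_le_lt_trans with 1; [|exact Ha].
  simpl. rewrite Rabs_pos_eq; lra. }
assert (Hrec : forall n, (u * (INR (S n) * h (S n)) + v * (INR n * h n))%C =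
  (k * h n)%C).
{ intros n. unfold h. rewrite ode_coeff_S.
  field. split; [exact Hune|apply INR_C_neq_0]. }
assert (Hend : ((PSeries p 1, PSeries r 1) : C) = Cexp (l 1)).
{ apply (Cexp_ode_unique (PSeries p) (PSeries r) (PSeries (PS_derive p))
    (PSeries (PS_derive r)) l (fun t => k / (u + t * v))%C).
  - intros t Ht. split; apply is_derive_PSeries; now apply Hin.
  - exact Hl.
  - intros t Ht.
    assert (Hne : (u + t * v)%C <> 0%C).
    { apply Cmod_gt_0.
      assert (T := Cmod_triangle (u + t * v) (- (t * v))).
      rewrite Cmod_opp, Cmod_mult, Cmod_R, (Rabs_pos_eq t) in T by lra.
      replace (u + t * v + - (t * v))%C with u in T by ring. nra. }
    assert (Ere := pseries_ode_re p r (Re u) (Im u) (Re v) (Im v) (Re k) (Im k) t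
      (Hin _ _ Ht Hrp) (Hin _ _ Ht Hrq)).
    assert (Eim := pseries_ode_re r p (Re u) (- Im u) (Re v) (- Im v) (Re k)
      (- Im k) t (Hin _ _ Ht Hrq) (Hin _ _ Ht Hrp)).
    assert (Hmul : ((u + t * v) *
      ((PSeries (PS_derive p) t, PSeries (PS_derive r) t) : C))%C =
      (k * ((PSeries p t, PSeries r t) : C))%C).
    { apply pair_equal_spec. unfold Re, Im in Ere, Eim. simpl. split.
      - etransitivity; [|etransitivity; [apply Ere|]]; [ring| |ring].
        intros n. assert (E := f_equal fst (Hrec n)).
        unfold p, r, Re, Im.
        cbn [fst snd Cmult Cplus RtoC] in E. lra.
      - etransitivity; [|etransitivity; [apply Eim|]]; [ring| |ring].
        intros n. assert (E := f_equal snd (Hrec n)).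
        unfold p, r, Re, Im.
        cbn [fst snd Cmult Cplus RtoC] in E. lra. }
    exact (C_eq_of_mult_eq _ _ _ _ Hne Hmul).
  - rewrite !PSeries_0. reflexivity. }
assert (Hser : forall a, Rbar_lt 1 (CV_radius a) -> is_series a (PSeries a 1)).
{ intros a Ha.
  assert (Hs := PSeries_correct a 1
    (CV_radius_inside a 1 ltac:(apply Hin; [lra|exact Ha]))).
  eapply is_series_ext; [|exact Hs]. intros n. simpl.
  rewrite pow_n_pow, pow1. apply Rmult_1_l. }
apply is_series_C; rewrite <- Hend; simpl; now apply Hser.
Qed.

Lemma ode_coeff_scale (u v k f0 z : C) (n : nat) : u <> 0%C ->
  ode_coeff u (v * z) (k * z) f0 n =
  (@pow_n C_AbsRing z n * ode_coeff u v k f0 n)%C.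
Proof.
intros Hu. induction n as [|n IH].
- symmetry. exact (Cmult_1_l f0).
- rewrite !ode_coeff_S, IH.
  change (@pow_n C_AbsRing z (S n)) with (z * @pow_n C_AbsRing z n)%C.
  set (w := @pow_n C_AbsRing z n).
  field. split; [exact Hu|apply INR_C_neq_0].
Qed.


(** * Operations on local power series *)

Lemma local_series_ext (a : nat -> C) (r : R) (f g : C -> C) :
  (forall z, Cmod z < r -> f z = g z) -> local_series a r f ->
  local_series a r g.
Proof. intros E H z Hz. rewrite <- E by exact Hz. now apply H. Qed.

Lemma local_series_plus (a a' : nat -> C) (r : R) (f g : C -> C) :
  local_series a r f -> local_series a' r g ->
  local_series (@PS_plus C_AbsRing C_NormedModule a a') r (fun z => f z + g z)%C.
Proof.
intros Hf Hg z Hz.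
exact (@is_pseries_plus C_AbsRing C_NormedModule a a' z _ _ (Hf z Hz) (Hg z Hz)).
Qed.

Lemma local_series_scal (c : C) (a : nat -> C) (r : R) (f : C -> C) :
  local_series a r f ->
  local_series (@PS_scal C_AbsRing C_NormedModule c a) r (fun z => c * f z)%C.
Proof.
intros Hf z Hz.
exact (@is_pseries_scal C_AbsRing C_NormedModule c a z _ (Cmult_comm z c) (Hf z Hz)).
Qed.

Definition times_id_coeff (z0 : C) (a : nat -> C) : nat -> C :=
  @PS_plus C_AbsRing C_NormedModule
    (@PS_scal C_AbsRing C_NormedModule z0 a) (@PS_incr_1 C_AbsRing C_NormedModule a).

Lemma local_series_times_id (z0 : C) (a : nat -> C) (r : R) (f : C -> C) :
  local_series a r f ->
  local_series (times_id_coeff z0 a) r (fun z => (z0 + z) * f z)%C.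
Proof.
intros Hf.
apply local_series_ext with (fun z => z0 * f z + z * f z)%C.
- intros z _. ring.
- apply local_series_plus; [now apply local_series_scal|].
  intros z Hz. exact (@is_pseries_incr_1 C_AbsRing C_NormedModule a z _ (Hf z Hz)).
Qed.

Lemma geometric_local_series (u v : C) (r : R) :
  u <> 0%C -> Cmod v * r <= Cmod u ->
  local_series (fun n => (- (v / u)) ^ n / u)%C r (fun z => / (u + v * z))%C.
Proof.
intros Hu Hvu z Hz.
assert (Hup : 0 < Cmod u) by now apply Cmod_gt_0.
assert (Hv := Cmod_ge_0 v). assert (Hz0 := Cmod_ge_0 z).
assert (Hlt : Cmod v * Cmod z < Cmod u).
{ destruct Hv as [Hv|Hv]; [nra|]. rewrite <- Hv. lra. }
assert (Hne : (u + v * z)%C <> 0%C).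
{ apply Cmod_gt_0. assert (T := Cmod_triangle (u + v * z) (- (v * z))).
  rewrite Cmod_opp, Cmod_mult in T.
  replace (u + v * z + - (v * z))%C with u in T by ring. lra. }
set (x := (- (v / u) * z)%C).
assert (Hx : Cmod x < 1).
{ unfold x. rewrite Cmod_mult, Cmod_opp, Cmod_div by exact Hu.
  apply Rmult_lt_reg_r with (Cmod u); [exact Hup|].
  replace (Cmod v / Cmod u * Cmod z * Cmod u) with (Cmod v * Cmod z)
    by (field; lra). lra. }
assert (Hstep : (1 - x)%C = ((u + v * z) / u)%C)
  by (unfold x; field; exact Hu).
set (term := fun k => (z ^ k * ((- (v / u)) ^ k / u))%C).
assert (Hterm : forall n, term n = (x ^ n / u)%C).
{ intros n. unfold term, x. rewrite Cpow_mult_l. field. exact Hu. }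
assert (Hsum : forall n, @sum_n C_AbelianMonoid term n =
  ((1 - x ^ S n) / (u + v * z))%C).
{ induction n as [|n IH].
  - rewrite sum_O, Hterm, Cpow_1_r, Hstep. change (x ^ 0)%C with (RtoC 1).
    match goal with |- @eq _ ?a ?b => change (@eq C a b) end.
    field. now split.
  - rewrite sum_Sn, IH, Hterm.
    match goal with |- @plus _ ?a ?b = ?c => change (@eq C (a + b)%C c) end.
    rewrite (Cpow_S x (S n)). set (y := (x ^ S n)%C).
    replace (y / u)%C with (y * (1 - x) / (u + v * z))%C
      by (rewrite Hstep; field; now split).
    field. exact Hne. }
apply (filterlim_locally (U := C_UniformSpace)). intros eps.
assert (Hg := is_lim_seq_geom (Cmod x)
  ltac:(rewrite Rabs_pos_eq; [exact Hx|apply Cmod_ge_0])).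
apply is_lim_seq_spec in Hg.
assert (Hc : 0 < Cmod (u + v * z)) by now apply Cmod_gt_0.
assert (Hp : 0 < eps * Cmod (u + v * z))
  by (apply Rmult_lt_0_compat; [apply cond_pos|exact Hc]).
destruct (Hg (mkposreal _ Hp)) as [N HN]. exists N. intros n Hn.
apply C_NormedModule_mixin_compat1.
change (Cmod (@sum_n C_AbelianMonoid term n - / (u + v * z)) < eps).
rewrite Hsum.
replace ((1 - x ^ S n) / (u + v * z) - / (u + v * z))%C
  with (- (x ^ S n / (u + v * z)))%C by (field; exact Hne).
rewrite Cmod_opp, Cmod_div, Cmod_pow by exact Hne.
specialize (HN (S n) ltac:(lia)). simpl pos in HN.
rewrite Rminus_0_r, Rabs_pos_eq in HN by (apply pow_le, Cmod_ge_0).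
apply Rmult_lt_reg_r with (Cmod (u + v * z)); [exact Hc|].
unfold Rdiv. rewrite Rmult_assoc, Rinv_l, Rmult_1_r by lra. exact HN.
Qed.

(** * The extremal function *)

(** On the right half-plane the argument is given by a formula that real
    calculus can differentiate. *)
Lemma Carg_right_half_plane (x y : R) : 0 < x -> Carg (x, y) = atan (y / x).
Proof.
intros Hx. unfold Carg. simpl.
set (m := Cmod (x, y)).
assert (Hm2 : m * m = x * x + y * y).
{ unfold m, Cmod. rewrite sqrt_sqrt; simpl; nra. }
assert (Hm0 : 0 <= m) by apply Cmod_ge_0.
assert (Hm : 0 < m) by nra.
assert (Hacos : acos (x / m) = atan (Rabs y / x)).
{ rewrite acos_atan by now apply Rdiv_lt_0_compat.
  f_equal.
  replace (1 - (x / m)²) with ((Rabs y / m)²).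
  - rewrite sqrt_Rsqr.
    + field. lra.
    + apply Rmult_le_pos; [apply Rabs_pos|]. left. now apply Rinv_0_lt_compat.
  - rewrite !Rsqr_div', <- Rsqr_abs. unfold Rsqr. rewrite Hm2. field. nra. }
rewrite Hacos. destruct (Rle_dec 0 y) as [Hy|Hy].
- now rewrite Rabs_pos_eq.
- rewrite Rabs_left by lra. rewrite <- atan_opp. f_equal. field. lra.
Qed.

Lemma Clog_path (w v : C) (t : R) :
  0 < Re (w + t * v) ->
  is_derive_path (fun s => Clog (w + s * v)) t (v / (w + t * v))%C.
Proof.
destruct w as [w1 w2], v as [v1 v2]. intros Hpos.
unfold Re in Hpos; simpl in Hpos.
replace (w1 + (t * v1 - 0 * v2)) with (w1 + t * v1) in Hpos by ring.
set (a := w1 + t * v1) in *. set (c := w2 + t * v2).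
assert (Hn : 0 < a * a + c * c) by nra.
split.
- apply (is_derive_ext (fun s => ln (sqrt ((w1 + s * v1) ^ 2 + (w2 + s * v2) ^ 2)))).
  + intros s. unfold Clog, Re, Cmod; simpl. do 2 f_equal. ring.
  + auto_derive; fold a c.
    * repeat split; try apply sqrt_lt_R0; nra.
    * replace (a * (a * 1) + c * (c * 1)) with (a * a + c * c) by ring.
      assert (Hs := sqrt_sqrt (a * a + c * c) ltac:(lra)).
      assert (Hsp := sqrt_lt_R0 _ Hn).
      set (q := sqrt (a * a + c * c)) in *.
      unfold Re; simpl. unfold a, c in *.
      field_simplify_eq; [|repeat split; nra].
      replace (q ^ 2) with (q * q) by ring. rewrite Hs. ring.
- apply (is_derive_ext_loc (fun s => atan ((w2 + s * v2) / (w1 + s * v1)))).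
  + assert (Hc : continuous (fun s => w1 + s * v1) t).
    { apply (ex_derive_continuous (fun s => w1 + s * v1)). auto_derive. exact I. }
    assert (Hpt : locally t (fun s => 0 < w1 + s * v1))
      by exact (Hc (fun y => 0 < y) (open_gt 0 _ Hpos)).
    revert Hpt. apply filter_imp. intros s Hs.
    unfold Clog, Im; cbn [snd].
    replace ((w1, w2) + s * (v1, v2))%C with ((w1 + s * v1, w2 + s * v2) : C)
      by (apply pair_equal_spec; simpl; split; ring).
    symmetry. apply Carg_right_half_plane. exact Hs.
  + auto_derive; fold a c.
    * lra.
    * unfold Im; simpl. unfold a, c in *. field. split; nra.
Qed.

Lemma is_derive_path_scal (c : C) (l : R -> C) (t : R) (d : C) :
  is_derive_path l t d -> is_derive_path (fun s => c * l s)%C t (c * d)%C.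
Proof.
intros [D1 D2]. destruct c as [c1 c2].
split; unfold Re, Im; simpl.
- apply (is_derive_minus (fun s => c1 * fst (l s)) (fun s => c2 * snd (l s))).
  + now apply (is_derive_scal (fun s => Re (l s))).
  + now apply (is_derive_scal (fun s => Im (l s))).
- apply (is_derive_plus (fun s => c1 * snd (l s)) (fun s => c2 * fst (l s))).
  + now apply (is_derive_scal (fun s => Im (l s))).
  + now apply (is_derive_scal (fun s => Re (l s))).
Qed.

Lemma is_derive_path_line (w v : C) (t : R) :
  is_derive_path (fun s => w + s * v)%C t v.
Proof.
destruct w as [w1 w2], v as [v1 v2].
split; unfold Re, Im; simpl; auto_derive; try exact I; ring.
Qed.

Lemma re_one_plus_pos (B : R) (z : C) :
  -1 <= B <= 1 -> unit_disc z -> 0 < Re (1 + B * z).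
Proof.
intros HB Hz. unfold unit_disc in Hz.
assert (H := re_le_Cmod z). apply Rabs_le_between in H.
destruct z as [x y]. unfold Re in *; simpl in *. nra.
Qed.

Lemma one_plus_neq_0 (B : R) (z : C) :
  -1 <= B <= 1 -> unit_disc z -> (1 + B * z)%C <> 0%C.
Proof.
intros HB Hz H. assert (T := re_one_plus_pos B z HB Hz).
rewrite H in T. unfold Re in T; simpl in T. lra.
Qed.

(** A logarithm of f_*(z) / z. *)
Definition star_log (A B : R) (b z : C) : C :=
  if Req_EM_T B 0 then (b * A * z)%C
  else (b * (A - B) / B * Clog (1 + B * z))%C.

Lemma f_star_eq (A B : R) (b z : C) :
  f_star A B b z = (z * Cexp (star_log A B b z))%C.
Proof. unfold f_star, star_log, Cpower. now destruct (Req_EM_T B 0). Qed.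

(** The derivative of [star_log] is b (A - B) / (1 + B z), whether or not
    [B = 0]. From here on the two cases of [f_star] are treated as one. *)
Lemma star_log_path (A B : R) (b z0 z : C) (t : R) :
  -1 <= B <= 1 -> unit_disc (z0 + t * z)%C ->
  is_derive_path (fun s => star_log A B b (z0 + s * z)) t
    (b * (A - B) * z / (1 + B * z0 + t * (B * z)))%C.
Proof.
intros HB Hz. unfold star_log. destruct (Req_EM_T B 0) as [->|HB0].
- replace (b * (A - 0) * z / (1 + 0 * z0 + t * (0 * z)))%C with (b * A * z)%C.
  + apply is_derive_path_scal, is_derive_path_line.
  + replace (1 + 0 * z0 + t * (0 * z))%C with (RtoC 1) by ring. field.
- assert (Hpos := re_one_plus_pos B _ HB Hz).
  assert (Hne := one_plus_neq_0 B _ HB Hz).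
  assert (E : forall s : R, (1 + B * (z0 + s * z))%C =
    (1 + B * z0 + s * (B * z))%C) by (intros s; ring).
  rewrite E in Hpos, Hne.
  assert (HB' : RtoC B <> 0%C) by (intros H; apply RtoC_inj in H; contradiction).
  replace (b * (A - B) * z / (1 + B * z0 + t * (B * z)))%C
    with (b * (A - B) / B * (B * z / (1 + B * z0 + t * (B * z))))%C
    by (field; now split).
  apply is_derive_path_scal.
  destruct (Clog_path _ _ _ Hpos) as [D1 D2]. split.
  + eapply is_derive_ext; [|exact D1]. intros s. cbv beta. now rewrite E.
  + eapply is_derive_ext; [|exact D2]. intros s. cbv beta. now rewrite E.
Qed.

(** The radius 1 - |z0| keeps [z0 + z] in the disc and, as |B| <= 1, ensures
    |B z| < |1 + B z0|, the convergence condition of [ode_series]. At [z0 = 0]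
    it is 1, so the expansion at the origin over the whole disc and the local
    ones at other points come from the same lemma. *)
Lemma star_factor_local_series (A B : R) (b z0 : C) :
  -1 <= B <= 1 -> unit_disc z0 ->
  local_series
    (ode_coeff (1 + B * z0) B (b * (A - B)) (Cexp (star_log A B b z0)))
    (1 - Cmod z0) (fun z => Cexp (star_log A B b (z0 + z))).
Proof.
intros HB Hz0 z Hz. unfold unit_disc in Hz0.
assert (N0 := Cmod_ge_0 z0). assert (N1 := Cmod_ge_0 z).
assert (HBabs : Rabs B <= 1) by (apply Rabs_le; lra).
assert (HB0 := Rabs_pos B).
assert (Hu : 1 - Cmod z0 <= Cmod (1 + B * z0)).
{ assert (T := Cmod_triangle (1 + B * z0) (- (B * z0))).
  rewrite Cmod_opp, Cmod_mult, Cmod_R in T.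
  replace (1 + B * z0 + - (B * z0))%C with (RtoC 1) in T by ring.
  rewrite Cmod_1 in T. nra. }
assert (Hser := ode_series (1 + B * z0) (B * z) (b * (A - B) * z)
  (fun t => star_log A B b (z0 + t * z))).
cbv beta in Hser.
replace (z0 + 0 * z)%C with z0 in Hser by ring.
replace (z0 + 1 * z)%C with (z0 + z)%C in Hser by ring.
assert (H : is_series (V := C_NormedModule) (ode_coeff (1 + B * z0) (B * z)
  (b * (A - B) * z) (Cexp (star_log A B b z0)))
  (Cexp (star_log A B b (z0 + z)))).
{ apply Hser.
  - rewrite Cmod_mult, Cmod_R. nra.
  - intros t Ht. apply star_log_path; [exact HB|]. unfold unit_disc.
    eapply Rle_lt_trans; [apply Cmod_triangle|].
    rewrite Cmod_mult, Cmod_R, Rabs_pos_eq by lra. nra. }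
eapply is_series_ext; [|exact H]. intros n.
apply ode_coeff_scale. apply Cmod_gt_0. lra.
Qed.

Lemma f_star_local_series (A B : R) (b z0 : C) :
  -1 <= B <= 1 -> unit_disc z0 ->
  local_series (times_id_coeff z0
    (ode_coeff (1 + B * z0) B (b * (A - B)) (Cexp (star_log A B b z0))))
    (1 - Cmod z0) (fun z => f_star A B b (z0 + z)).
Proof.
intros HB Hz0.
eapply local_series_ext;
  [|apply local_series_times_id, star_factor_local_series; eassumption].
intros z _. now rewrite f_star_eq.
Qed.

Lemma Cexp_neq_0 (z : C) : Cexp z <> 0%C.
Proof.
intros H. apply pair_equal_spec in H. destruct H as [H1 H2].
assert (E := exp_pos (Re z)). assert (T := sin2_cos2 (Im z)).
unfold Rsqr in T. apply Rmult_integral in H1, H2.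
destruct H1 as [H1|H1]; [lra|]. destruct H2 as [H2|H2]; [lra|].
rewrite H1, H2 in T. lra.
Qed.

Lemma f_star_neq_0 (A B : R) (b z : C) : z <> 0%C -> f_star A B b z <> 0%C.
Proof.
intros Hz. rewrite f_star_eq. apply Cmult_neq_0; [exact Hz|apply Cexp_neq_0].
Qed.

Lemma C_derive_f_star (A B : R) (b z : C) :
  -1 <= B <= 1 -> unit_disc z ->
  C_derive (f_star A B b) z =
  (Cexp (star_log A B b z) * (1 + b * (A - B) * z / (1 + B * z)))%C.
Proof.
intros HB Hz.
rewrite (C_derive_local_series _ (1 - Cmod z) _ z
  ltac:(unfold unit_disc in Hz; lra) (f_star_local_series A B b z HB Hz)).
set (E := Cexp (star_log A B b z)).
transitivity (z * ((b * (A - B) - 0 * B) * E / (1 * (1 + B * z))) + E)%C.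
- reflexivity.
- field. now apply one_plus_neq_0.
Qed.

(** At the origin, where the value is a limit, the formula for the other points
    converges to 1. *)
Lemma star_quotient_f_star (A B : R) (b z : C) :
  -1 <= B <= 1 -> unit_disc z ->
  star_quotient (f_star A B b) z = (1 + b * (A - B) * (z / (1 + B * z)))%C.
Proof.
intros HB Hz.
assert (Hq : forall w, unit_disc w -> w <> 0%C ->
  (w * C_derive (f_star A B b) w / f_star A B b w)%C =
  (1 + b * (A - B) * (w / (1 + B * w)))%C).
{ intros w Hw Hw0. rewrite C_derive_f_star, f_star_eq by assumption.
  field. repeat split; [now apply one_plus_neq_0|apply Cexp_neq_0|exact Hw0]. }
unfold star_quotient. destruct (Ceq_dec z 0%C) as [->|Hz0]; [|now apply Hq].
replace (1 + b * (A - B) * (0 / (1 + B * 0)))%C with (RtoC 1)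
  by (field; replace (1 + B * 0)%C with (RtoC 1) by ring; intros H; injection H; lra).
apply (C_lim_lipschitz _ _ _ (Cmod (b * (A - B)) * 2) (/ 2)); [lra|].
intros w Hw0 Hw. replace (w - 0)%C with w in * by ring.
rewrite Hq by (unfold unit_disc; assumption || lra).
replace (1 + b * (A - B) * (w / (1 + B * w)) - 1)%C
  with (b * (A - B) * (w / (1 + B * w)))%C by ring.
rewrite (Cmod_mult (b * (A - B))).
assert (N := Cmod_ge_0 (b * (A - B))). assert (N1 := Cmod_ge_0 w).
rewrite Rmult_assoc. apply Rmult_le_compat_l; [exact N|].
rewrite Cmod_div by (apply one_plus_neq_0; [exact HB|unfold unit_disc; lra]).
assert (Hlow : / 2 <= Cmod (1 + B * w)).
{ assert (T := Cmod_triangle (1 + B * w) (- (B * w))).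
  rewrite Cmod_opp, Cmod_mult, Cmod_R in T.
  replace (1 + B * w + - (B * w))%C with (RtoC 1) in T by ring.
  rewrite Cmod_1 in T.
  assert (HBabs : Rabs B <= 1) by (apply Rabs_le; lra).
  assert (HB0 := Rabs_pos B). nra. }
apply Rmult_le_reg_r with (Cmod (1 + B * w)); [lra|].
unfold Rdiv. rewrite Rmult_assoc, Rinv_l by lra. nra.
Qed.

Lemma local_series_analytic_at (a : nat -> C) (r : R) (f : C -> C) (z0 : C) :
  0 < r -> local_series a r (fun z => f (z0 + z)%C) -> analytic_at f z0.
Proof.
intros Hr H. exists a, r. split; [exact Hr|]. intros z Hz.
specialize (H (z - z0)%C Hz). cbv beta in H.
now replace (z0 + (z - z0))%C with z in H by ring.
Qed.

Lemma local_series_expansion (a : nat -> C) (f : C -> C) :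
  local_series a (1 - Cmod 0) (fun z => f (0 + z)%C) -> expansion_in_disc a f.
Proof.
intros H z Hz. unfold unit_disc in Hz.
specialize (H z ltac:(rewrite Cmod_0; lra)). cbv beta in H.
now rewrite Cplus_0_l in H.
Qed.

Lemma Omega_id : Omega (fun z => z).
Proof.
split; [|split; [reflexivity|intros z Hz; exact Hz]].
intros z0 _.
apply (local_series_analytic_at (times_id_coeff z0
  (fun n => (- (0 / 1)) ^ n / 1)%C) 1); [lra|].
(* The constant 1 is a geometric series of ratio 0. *)
apply local_series_ext with (fun z => (z0 + z) * / (1 + 0 * z))%C.
- intros z _. replace (1 + 0 * z)%C with (RtoC 1) by ring. field.
- apply local_series_times_id, geometric_local_series.
  + intros H; injection H; lra.
  + rewrite Cmod_0, Cmod_1. lra.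
Qed.

(** The member of P(A, B) given by the identity of the disc. *)
Definition mobius (A B : R) (z : C) : C := ((1 + A * z) / (1 + B * z))%C.

Definition mobius_coeff (A B : R) (z0 : C) : nat -> C :=
  let g := (fun n => (- (B / (1 + B * z0))) ^ n /
    (1 + B * z0))%C in
  @PS_plus C_AbsRing C_NormedModule g
    (@PS_scal C_AbsRing C_NormedModule (RtoC A) (times_id_coeff z0 g)).

Lemma mobius_local_series (A B : R) (z0 : C) :
  -1 <= B <= 1 -> unit_disc z0 ->
  local_series (mobius_coeff A B z0) (1 - Cmod z0)
    (fun z => mobius A B (z0 + z)).
Proof.
intros HB Hz0.
assert (N0 := Cmod_ge_0 z0). assert (Hz0' := Hz0). unfold unit_disc in Hz0'.
apply local_series_ext with (fun z => / (1 + B * z0 + B * z) +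
  A * ((z0 + z) * / (1 + B * z0 + B * z)))%C.
- intros z Hz. unfold mobius.
  assert (Hne : (1 + B * (z0 + z))%C <> 0%C).
  { apply one_plus_neq_0; [exact HB|]. unfold unit_disc.
    eapply Rle_lt_trans; [apply Cmod_triangle|lra]. }
  replace (1 + B * z0 + B * z)%C with (1 + B * (z0 + z))%C by ring.
  field. exact Hne.
- assert (G : local_series (fun n => (- (B / (1 + B * z0))) ^ n /
    (1 + B * z0))%C (1 - Cmod z0) (fun z => / (1 + B * z0 + B * z))%C).
  { apply geometric_local_series; [now apply one_plus_neq_0|].
    assert (T := Cmod_triangle (1 + B * z0) (- (B * z0))).
    rewrite Cmod_opp, Cmod_mult, !Cmod_R in *.
    replace (1 + B * z0 + - (B * z0))%C with (RtoC 1) in T by ring.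
    rewrite Cmod_1 in T.
    assert (HBabs : Rabs B <= 1) by (apply Rabs_le; lra).
    assert (HB0 := Rabs_pos B). nra. }
  apply local_series_plus; [exact G|].
  now apply local_series_scal, local_series_times_id.
Qed.

Lemma P_class_mobius (A B : R) : -1 <= B <= 1 -> P_class A B (mobius A B).
Proof.
intros HB.
assert (H00 : unit_disc 0%C) by (unfold unit_disc; rewrite Cmod_0; lra).
split; [|split].
- intros z0 Hz0.
  apply (local_series_analytic_at _ (1 - Cmod z0) _ _
    ltac:(unfold unit_disc in Hz0; lra) (mobius_local_series A B z0 HB Hz0)).
- exists (mobius_coeff A B 0). split.
  + change (1 / (1 + B * 0) + A * (0 * (1 / (1 + B * 0)) + 0) = 1)%C.
    replace (1 + B * 0)%C with (RtoC 1) by ring. field.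
  + now apply local_series_expansion, mobius_local_series.
- exists (fun z => z). split; [apply Omega_id|reflexivity].
Qed.

Lemma S_star_f_star (A B : R) (b : C) :
  -1 <= B <= 1 -> b <> 0%C -> S_star A B b (f_star A B b).
Proof.
intros HB Hb.
assert (H00 : unit_disc 0%C) by (unfold unit_disc; rewrite Cmod_0; lra).
split; [|split; [|split]].
- intros z0 Hz0.
  apply (local_series_analytic_at _ (1 - Cmod z0) _ _
    ltac:(unfold unit_disc in Hz0; lra) (f_star_local_series A B b z0 HB Hz0)).
- eexists. split; [|split].
  3: { apply local_series_expansion, f_star_local_series; assumption. }
  + set (E := Cexp (star_log A B b 0)).
    change (0 * E + 0 = 0)%C. ring.
  + assert (EL : star_log A B b 0 = 0%C).
    { unfold star_log. destruct (Req_EM_T B 0) as [_|_]; [ring|].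
      replace (1 + B * 0)%C with (RtoC 1) by ring.
      replace (Clog 1) with (RtoC 0); [ring|].
      unfold Clog. rewrite Cmod_1, ln_1. unfold RtoC. f_equal.
      rewrite Carg_right_half_plane by lra.
      replace (0 / 1) with 0 by lra. symmetry. apply atan_0. }
    set (G := ode_coeff (1 + B * 0) B (b * (A - B))
      (Cexp (star_log A B b 0)) 1%nat).
    change (0 * G + Cexp (star_log A B b 0) = 1)%C.
    rewrite EL. unfold Cexp, Re, Im; simpl.
    rewrite exp_0, cos_0, sin_0. replace ((1 * 1, 1 * 0) : C) with (RtoC 1).
    * ring.
    * apply pair_equal_spec. split; ring.
- intros z _. apply f_star_neq_0.
- exists (mobius A B). split; [now apply P_class_mobius|].
  intros z Hz. rewrite star_quotient_f_star by assumption.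
  unfold mobius. field. split; [now apply one_plus_neq_0|exact Hb].
Qed.

(** * The radius *)

(** The image of the circle |w| = rho under w / (1 + B w) is the circle with
    centre - B rho^2 / (1 - B^2 rho^2) and radius rho / (1 - B^2 rho^2), since
    w + B rho^2 = w conj(1 + B w). *)
Lemma Cmod_recentered (B : R) (w : C) :
  B ^ 2 * Cmod w ^ 2 < 1 -> (1 + B * w)%C <> 0%C ->
  Cmod (w / (1 + B * w) +
    RtoC (B * Cmod w ^ 2 / (1 - B ^ 2 * Cmod w ^ 2))) =
  Cmod w / (1 - B ^ 2 * Cmod w ^ 2).
Proof.
intros Hlt Hne. set (d := 1 - B ^ 2 * Cmod w ^ 2).
assert (Hd : 0 < d) by (unfold d; lra).
assert (Hdne : RtoC d <> 0%C) by (intros H; apply RtoC_inj in H; lra).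
assert (E : (w / (1 + B * w) + RtoC (B * Cmod w ^ 2 / d))%C =
  (w * Cconj (1 + B * w) / ((1 + B * w) * d))%C).
{ assert (Hcm : RtoC (Cmod w ^ 2) = (w * Cconj w)%C) by apply Cmod2_conj.
  assert (Hdc : RtoC d = (1 - B ^ 2 * (w * Cconj w))%C).
  { unfold d. rewrite RtoC_minus, RtoC_mult, Hcm, RtoC_pow. reflexivity. }
  rewrite RtoC_div by lra. rewrite RtoC_mult, Hcm.
  replace (Cconj (1 + B * w)) with (1 + B * Cconj w)%C.
  - transitivity ((w * d + B * (w * Cconj w) * (1 + B * w)) / ((1 + B * w) * d))%C;
      [field; now split|].
    f_equal. rewrite Hdc. ring.
  - apply pair_equal_spec; simpl. split; ring. }
rewrite E, Cmod_div by now apply Cmult_neq_0.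
rewrite !Cmod_mult, Cmod_conj, (Cmod_R d), (Rabs_pos_eq d) by lra.
assert (0 < Cmod (1 + B * w)) by now apply Cmod_gt_0.
field. lra.
Qed.

(** The numerator of the minimum of Re(1 + b (A - B) w / (1 + B w)) over the
    circle |w| = r. *)
Definition radius_quadratic (A B : R) (b : C) (r : R) : R :=
  1 - Cmod b * (A - B) * r - (B ^ 2 + (A * B - B ^ 2) * Re b) * r ^ 2.

(** Re(b s) >= - |b| |s| where [s] is the deviation from the centre found in
    [Cmod_recentered]. *)
Lemma Re_disc_lower_bound (A B : R) (b w : C) :
  B < A -> B ^ 2 * Cmod w ^ 2 < 1 -> (1 + B * w)%C <> 0%C ->
  radius_quadratic A B b (Cmod w) / (1 - B ^ 2 * Cmod w ^ 2) <=
  Re (1 + b * (A - B) * (w / (1 + B * w))).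
Proof.
intros HAB Hlt Hne.
assert (Hmod := Cmod_recentered B w Hlt Hne).
set (d := 1 - B ^ 2 * Cmod w ^ 2) in *.
assert (Hd : 0 < d) by (unfold d; lra).
set (c := B * Cmod w ^ 2 / d) in *.
set (q := (w / (1 + B * w))%C) in *.
assert (H := re_le_Cmod (b * (q + c))).
rewrite Cmod_mult, Hmod in H. apply Rabs_le_between in H.
destruct H as [H _].
replace (Re (1 + b * (A - B) * q))
  with (1 + (A - B) * (Re (b * (q + c)) - c * Re b)).
2: { destruct b, q. unfold Re; simpl. ring. }
replace (radius_quadratic A B b (Cmod w) / d)
  with (1 + (A - B) * (- (Cmod b * (Cmod w / d)) - c * Re b)).
2: { unfold radius_quadratic, c.
     apply Rmult_eq_reg_r with d; [|lra].
     field_simplify; [|lra|lra]. unfold d. ring. }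
nra.
Qed.

(** As |Re b| <= |b|, the discriminant is at least
    (|b| (A - B) - 2 |B|)^2. Hence the square root in [r_s] is the genuine
    one. *)
Lemma radius_discriminant_ge_0 (A B : R) (b : C) :
  B < A ->
  0 <= Cmod b ^ 2 * (A - B) ^ 2 + 4 * (B ^ 2 + (A * B - B ^ 2) * Re b).
Proof.
intros HAB. assert (H := re_le_Cmod b). apply Rabs_le_between in H.
assert (N := Cmod_ge_0 b).
set (m := Cmod b) in *. set (x := Re b) in *. set (a := A - B).
replace (A * B - B ^ 2) with (a * B) by (unfold a; ring).
assert (Ha : 0 < a) by (unfold a; lra).
destruct (Rle_dec 0 B) as [HB|HB].
- assert (0 <= (m * a - 2 * B) ^ 2) by apply pow2_ge_0.
  assert (0 <= a * B) by nra. nra.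
- assert (0 <= (m * a + 2 * B) ^ 2) by apply pow2_ge_0.
  assert (0 <= a * - B) by nra. nra.
Qed.

(** With beta and gamma the coefficients of the quadratic
    1 - beta r - gamma r^2, and r_s = 2 / T, four times the quadratic factors as
    (2 - T r) (2 + T r - 2 beta r). As T >= beta, the second factor is positive
    for 0 <= r < r_s. *)
Lemma r_s_factor (A B : R) (b : C) :
  B < A -> b <> 0%C ->
  0 < r_s A B b /\ radius_quadratic A B b (r_s A B b) = 0 /\
  forall r, 0 <= r < r_s A B b -> 0 < radius_quadratic A B b r.
Proof.
intros HAB Hb.
assert (Hdisc := radius_discriminant_ge_0 A B b HAB).
assert (Hm : 0 < Cmod b) by now apply Cmod_gt_0.
unfold r_s, radius_quadratic.
set (beta := Cmod b * (A - B)).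
set (gamma := B ^ 2 + (A * B - B ^ 2) * Re b) in *.
replace (Cmod b ^ 2 * (A - B) ^ 2) with (beta ^ 2) in * by (unfold beta; ring).
assert (Hs := sqrt_sqrt _ Hdisc). assert (Hs0 := sqrt_pos (beta ^ 2 + 4 * gamma)).
set (s := sqrt (beta ^ 2 + 4 * gamma)) in *.
assert (Hbeta : 0 < beta) by (unfold beta; apply Rmult_lt_0_compat; lra).
set (T := beta + s). assert (HT : 0 < T) by (unfold T; lra).
assert (Hg : 4 * gamma = T ^ 2 - 2 * beta * T) by (unfold T; nra).
assert (Hfac : forall r, 4 * (1 - beta * r - gamma * r ^ 2) =
  (2 - T * r) * (2 + T * r - 2 * beta * r)).
{ intros r.
  replace (4 * (1 - beta * r - gamma * r ^ 2))
    with (4 - 4 * beta * r - 4 * gamma * r ^ 2) by ring.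
  rewrite Hg. ring. }
assert (HT2 : T * (2 / T) = 2) by (field; lra).
split; [apply Rdiv_lt_0_compat; lra|]. split.
- specialize (Hfac (2 / T)). rewrite HT2 in Hfac. lra.
- intros r [Hr0 Hr].
  assert (HTr : T * r < 2) by (rewrite <- HT2; now apply Rmult_lt_compat_l).
  assert (beta * r <= T * r) by (apply Rmult_le_compat_r; unfold T; lra).
  specialize (Hfac r).
  assert (0 < (2 - T * r) * (2 + T * r - 2 * beta * r))
    by (apply Rmult_lt_0_compat; lra).
  lra.
Qed.

(** Equality in [Re_disc_lower_bound]: the deviation from the centre must point
    against conj(b). Solving for [z], with e = conj(b) / |b|, gives
    z = - r (B r + e) / (1 + B r e), of modulus [r] because |e| = 1. *)
Lemma extremal_point (A B : R) (b : C) (r : R) :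
  b <> 0%C -> 0 <= r -> B ^ 2 * r ^ 2 < 1 ->
  exists z, Cmod z = r /\
    Re (1 + b * (A - B) * (z / (1 + B * z))) =
    radius_quadratic A B b r / (1 - B ^ 2 * r ^ 2).
Proof.
intros Hb Hr Hlt.
assert (Hm : 0 < Cmod b) by now apply Cmod_gt_0.
assert (Hmc : RtoC (Cmod b) <> 0%C) by (intros H; apply RtoC_inj in H; lra).
set (e := (Cconj b / Cmod b)%C).
assert (He : Cmod e = 1).
{ unfold e. rewrite Cmod_div, Cmod_conj, Cmod_R, Rabs_pos_eq by (assumption || lra).
  field. lra. }
assert (Hee : (e * Cconj e)%C = 1%C).
{ rewrite <- Cmod2_conj, He. f_equal. ring. }
set (d := 1 - B ^ 2 * r ^ 2). assert (Hd : 0 < d) by (unfold d; lra).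
assert (Hdne : RtoC d <> 0%C) by (intros H; apply RtoC_inj in H; lra).
assert (Hdc : RtoC d = (1 - B ^ 2 * r ^ 2)%C).
{ unfold d. now rewrite RtoC_minus, RtoC_mult, !RtoC_pow. }
assert (Hden : (1 + B * r * e)%C <> 0%C).
{ apply Cmod_gt_0. assert (T := Cmod_triangle (1 + B * r * e) (- (B * r * e))).
  rewrite Cmod_opp, !Cmod_mult, !Cmod_R, He, (Rabs_pos_eq r) in T by exact Hr.
  replace (1 + B * r * e + - (B * r * e))%C with (RtoC 1) in T by ring.
  rewrite Cmod_1 in T.
  assert (Rabs B * r < 1).
  { assert (Rabs B ^ 2 = B ^ 2) by apply pow2_abs.
    assert (0 <= Rabs B * r) by (apply Rmult_le_pos; [apply Rabs_pos|lra]). nra. }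
  lra. }
exists (- r * (B * r + e) / (1 + B * r * e))%C. split.
- rewrite Cmod_div, Cmod_mult, Cmod_opp, Cmod_R, (Rabs_pos_eq r) by assumption.
  replace (B * r + e)%C with (e * Cconj (1 + B * r * e))%C.
  + rewrite Cmod_mult, Cmod_conj, He.
    assert (0 < Cmod (1 + B * r * e)) by now apply Cmod_gt_0. field. lra.
  + replace (Cconj (1 + B * r * e)) with (1 + B * r * Cconj e)%C
      by (apply pair_equal_spec; simpl; split; ring).
    transitivity (e + B * r * (e * Cconj e))%C; [ring|]. rewrite Hee. ring.
- set (z := (- r * (B * r + e) / (1 + B * r * e))%C).
  assert (Hz1 : (1 + B * z)%C = (d / (1 + B * r * e))%C).
  { rewrite Hdc. unfold z. field. exact Hden. }
  assert (Hq : (b * (z / (1 + B * z)))%C = (- r * (B * r * b + Cmod b) / d)%C).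
  { rewrite Hz1. unfold z.
    transitivity (- r * (B * r * b + b * e) / d)%C; [field; now split|].
    do 3 f_equal. unfold e.
    transitivity (b * Cconj b / Cmod b)%C; [field; exact Hmc|].
    rewrite <- Cmod2_conj, RtoC_pow. field. exact Hmc. }
  replace (b * (A - B) * (z / (1 + B * z)))%C
    with ((A - B) * (b * (z / (1 + B * z))))%C by ring.
  rewrite Hq.
  replace (- r * (B * r * b + Cmod b) / d)%C
    with (RtoC (- r / d) * (B * r * b + Cmod b))%C.
  2: { rewrite RtoC_div, RtoC_opp by lra. field. exact Hdne. }
  unfold radius_quadratic. fold d. destruct b as [b1 b2]. unfold Re. simpl.
  set (m := Cmod (b1, b2)).
  apply Rmult_eq_reg_r with d; [|lra].
  field_simplify; [|lra|lra]. unfold d. ring.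
Qed.

Theorem theorem2p1 (A B : R) (b : C)
  (hA : -1 < A <= 1) (hB : -1 <= B < A) (hb : b <> 0%C) :
  is_radius_of_starlikeness (S_star A B b) (r_s A B b) /\
  is_extremal_function (S_star A B b) (r_s A B b) (f_star A B b).
Proof.
assert (HB : -1 <= B <= 1) by lra.
assert (Hsq : forall r, 0 <= r < 1 -> B ^ 2 * r ^ 2 < 1).
{ intros r Hr. replace (B ^ 2 * r ^ 2) with ((B * r) * (B * r)) by ring.
  assert (-1 < B * r < 1) by nra. nra. }
destruct (r_s_factor A B b ltac:(lra) hb) as (Hrs0 & Hroot & Hpos).
assert (Hmem := S_star_f_star A B b HB hb).
assert (Hext : forall r, r_s A B b < r <= 1 ->
  starlike_fails_within (f_star A B b) r).
{ intros r Hr.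
  destruct (extremal_point A B b (r_s A B b) hb ltac:(lra)
    (Hsq (r_s A B b) ltac:(lra))) as (z & Hz & Hre).
  exists z. split; [lra|].
  rewrite star_quotient_f_star by (exact HB || (unfold unit_disc; lra)).
  rewrite Hre, Hroot. unfold Rdiv. rewrite Rmult_0_l. lra. }
split; [split|split].
- intros f (_ & _ & _ & p & (_ & _ & w & Hw & Hp) & Hf) z Hz Hzr.
  assert (Hwz := schwarz w Hw z Hz). unfold unit_disc in Hz.
  assert (Hw0 := Cmod_ge_0 (w z)).
  assert (Hne : (1 + B * w z)%C <> 0%C)
    by (apply one_plus_neq_0; [exact HB|unfold unit_disc; lra]).
  assert (E : star_quotient f z = (1 + b * (A - B) * (w z / (1 + B * w z)))%C).
  { transitivity (1 + b * ((1 + 1 / b * (star_quotient f z - 1)) - 1))%C;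
      [field; exact hb|].
    rewrite Hf, Hp by exact Hz. field. exact Hne. }
  rewrite E.
  assert (Hs := Hsq (Cmod (w z)) ltac:(lra)).
  eapply Rlt_le_trans;
    [|apply Re_disc_lower_bound; [lra|exact Hs|exact Hne]].
  apply Rdiv_lt_0_compat; [apply Hpos; lra|lra].
- intros r Hr. exists (f_star A B b). split; [exact Hmem|now apply Hext].
- exact Hmem.
- exact Hext.
Qed.
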